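(* For every Noetherian space $X$, $||X^\circledast|| = \omega^{\widehat{\alpha}}$, where $\alpha = ||X||$.
   Context: A topological space is Noetherian if every open subset is compact (every open cover has a finite subcover; no separation is required). For a well-founded poset $P$ and $x \in P$, $\mathrm{rk}_P(x) = \sup_{x' < x} (\mathrm{rk}_P(x')+1)$ and the ordinal rank of $P$ is $|P| = \sup_{x \in P} (\mathrm{rk}_P(x)+1)$, where $\sup\emptyset = 0$. $\mathcal{H}_0 X$ is the poset of all closed subsets of $X$ (including $\emptyset$), ordered by inclusion; it is well-founded when $X$ is Noetherian. The stature of a Noetherian space $X$ is $||X|| = |\mathcal{H}_0 X| - 1$, equivalently $||X|| = \mathrm{rk}_{\mathcal{H}_0 X}(X)$. $X^*$ is the set of finite words over $X$ with the word topology: the topology generated by the subsets $X^* U_1 X^* U_2 X^* \cdots X^* U_n X^*$ (concatenation of sets of words), where $n \in \mathbb{N}$ and $U_1, \ldots, U_n$ are open subsets of $X$. $X^\circledast$ is the set of finite multisets over $X$, i.e. maps $m \colon X \to \mathbb{N}$ with $m(x) = 0$ for all but finitely many $x$, with the quotient topology induced by the Parikh mapping $\Psi \colon X^* \to X^\circledast$, which maps a word $w$ to the multiset counting the number of occurrences of each $x \in X$ in $w$. $X^\circledast$ is Noetherian when $X$ is. A critical ordinal is an ordinal $\epsilon$ such that $\epsilon = \omega^\epsilon$. For every ordinal $\alpha$, $\alpha^\circ$ is $\alpha + 1$ if $\alpha = \epsilon + n$ for some critical ordinal $\epsilon$ and some $n \in \mathbb{N}$, and $\alpha^\circ = \alpha$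 otherwise. For every ordinal $\alpha$, written in Cantor normal form as $\omega^{\alpha_1} + \cdots + \omega^{\alpha_m}$ with $\alpha \geq \alpha_1 \geq \cdots \geq \alpha_m$, $m \in \mathbb{N}$, the ordinal $\widehat{\alpha}$ is $\omega^{\alpha_1^\circ} + \cdots + \omega^{\alpha_m^\circ}$ (so $\widehat{0} = 0$). *)

(* Defs.v *)
From HB Require Import structures.
From Stdlib Require Import ClassicalEpsilon.
From mathcomp Require Import all_boot finmap multiset.
From mathcomp Require Import all_classical.
From mathcomp Require Import topology.

Set Implicit Arguments.
Unset Strict Implicit.
Unset Printing Implicit Defensive.

Local Open Scope classical_set_scope.

(* Ordinals as well-founded trees: [osup f] is the least ordinal strictly
   above every [f i], i.e. sup_i (f i + 1).  Distinct trees may denote the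
   same ordinal, so equality of ordinals is [oeq], not Leibniz equality. *)
Inductive Ord : Type := osup (K : Type) (f : K -> Ord).

(* sup_i (f i + 1) <= sup_j (g j + 1) iff every f i is below some g j. *)
Fixpoint ole (a b : Ord) {struct a} : Prop :=
  let: osup K f := a in
  let: osup L g := b in
  forall i : K, exists j : L, ole (f i) (g j).

Definition oeq (a b : Ord) : Prop := ole a b /\ ole b a.

Declare Scope ord_scope.
Delimit Scope ord_scope with ord.
Notation "a =ord b" := (oeq a b) (at level 70, no associativity) : ord_scope.
Local Open Scope ord_scope.

Definition ozero : Ord := osup (of_void Ord).

Definition osucc (a : Ord) : Ord := osup (fun _ : unit => a).

(* a + sup_j (g j + 1): the strict supremum of the c < a and the a + g j. *)
Fixpoint oadd (a b : Ord) {struct b} : Ord :=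
  let: osup K f := a in
  let: osup L g := b in
  osup (fun k : K + L =>
          match k with inl i => f i | inr j => oadd a (g j) end).

Definition onat (n : nat) : Ord := iter n osucc ozero.

Definition omuln (a : Ord) (n : nat) : Ord := iter n (fun b => oadd b a) ozero.

(* omega ^ a, as the strict supremum of 0 and of the omega ^ b * n for b < a
   and n : nat; this is 1 for a = 0, sup_n (omega ^ b * n) for a = b + 1 and
   sup_(b < a) omega ^ b for a limit. *)
Fixpoint opow (a : Ord) : Ord :=
  let: osup K f := a in
  osup (fun k : option (K * nat) =>
          match k with
          | None => ozero
          | Some (i, n) => omuln (opow (f i)) n
          end).

Definition critical (e : Ord) : Prop := e =ord opow e.

Definition circ (a : Ord) : Ord :=
  if pselect (exists e n, critical e /\ a =ord oadd e (onat n)) then osucc a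
  else a.

Definition sum_opow (s : seq Ord) : Ord := foldr oadd ozero (map opow s).

(* [path] on a boolean version of [ole] would confine ordinals to a universe
   too small to contain the ranks of all topological spaces. *)
Fixpoint nonincreasing (a : Ord) (s : seq Ord) : Prop :=
  if s is b :: s' then ole b a /\ nonincreasing b s' else True.

(* a = omega ^ a_1 + ... + omega ^ a_m with a >= a_1 >= ... >= a_m. *)
Definition is_cnf (a : Ord) (s : seq Ord) : Prop :=
  nonincreasing a s /\ a =ord sum_opow s.

(* By Cantor's theorem [is_cnf a] is inhabited, uniquely up to [oeq]. *)
Definition cnf (a : Ord) : seq Ord := epsilon (inhabits [::]) (is_cnf a).

Definition hat (a : Ord) : Ord := sum_opow (map circ (cnf a)).

Section Rank.
Variables (P : Type) (lt : P -> P -> Prop).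

Fixpoint rank_acc (x : P) (ax : Acc lt x) {struct ax} : Ord :=
  osup (fun y : {y | lt y x} => rank_acc (Acc_inv ax (proj2_sig y))).

(* The value [ozero] at inaccessible points is a dummy: there are none when
   [lt] is well-founded. *)
Definition rank (x : P) : Ord :=
  match pselect (Acc lt x) with
  | left ax => rank_acc ax
  | right _ => ozero
  end.

Definition ordinal_rank : Ord := osup rank.

End Rank.

Definition noetherian (X : topologicalType) : Prop :=
  forall U : set X, open U -> cover_compact U.

Section Stature.
Variable X : topologicalType.

Definition hoare0 : Type := {A : set X | closed A}.

Definition hoare0_lt (A B : hoare0) : Prop := sval A `<` sval B.

Definition hoare0_top : hoare0 := exist _ setT closedT.

(* This is |H_0 X| - 1, see [ordinal_rank_stature] below. *)
Definition stature : Ord := rank hoare0_lt hoare0_top.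

End Stature.

Section Words.
Variable X : Type.

Definition lang_cat (A B : set (seq X)) : set (seq X) :=
  [set u ++ v | u in A & v in B].

Definition letters (U : set X) : set (seq X) := [set [:: x] | x in U].

(* X^* U_1 X^* U_2 X^* ... U_n X^* *)
Definition word_basic (Us : seq (set X)) : set (seq X) :=
  foldr (fun U L => lang_cat setT (lang_cat (letters U) L)) setT Us.

End Words.

HB.instance Definition _ (T : choiceType) := isPointed.Build (seq T) [::].

Definition word_space (X : Type) : Type := seq X.
HB.instance Definition _ (X : choiceType) := Choice.on (word_space X).
HB.instance Definition _ (X : topologicalType) :=
  @isSubBaseTopological.Build (word_space X) (seq (set X))
    [set Us : seq (set X) | forall U, U \in Us -> open U] (@word_basic X).

Definition multiset_space (X : choiceType) : Type := {mset X}%mset.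
HB.instance Definition _ (X : choiceType) := Choice.on (multiset_space X).

Definition parikh (X : choiceType) (w : word_space X) : multiset_space X :=
  seq_mset w.

Section QuotientTopology.
Variable X : topologicalType.

Definition multiset_open : set (set (multiset_space X)) :=
  [set V | open (@parikh X @^-1` V)].

Fact multiset_openT : multiset_open setT.
Proof. by rewrite /multiset_open /= preimage_setT; exact: openT. Qed.

Fact multiset_openI : setI_closed multiset_open.
Proof. by move=> U V oU oV; exact: openI. Qed.

Fact multiset_open_bigU (I : Type) (f : I -> set (multiset_space X)) :
  (forall i, multiset_open (f i)) -> multiset_open (\bigcup_i f i).
Proof.
by move=> fo; rewrite /multiset_open /= preimage_bigcup; apply: bigcup_open => i _; exact: fo.
Qed.

HB.instance Definition _ := isOpenTopological.Build (multiset_space X)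
  multiset_openT multiset_openI multiset_open_bigU.

End QuotientTopology.

Lemma ole_refl (a : Ord) : ole a a.
Proof. by elim: a => K f IHf i; exists i; exact: IHf. Qed.

Lemma ole_trans (a b c : Ord) : ole a b -> ole b c -> ole a c.
Proof.
elim: a b c => K f IHf [L g] [M h] fg gh i.
have [j fgj] := fg i; have [k ghk] := gh j.
by exists k; exact: IHf fgj ghk.
Qed.

Lemma noetherian_wf (X : topologicalType) :
  noetherian X -> well_founded (@hoare0_lt X).
Proof.
move=> nX A; apply: contrapT => nA.
have step (B : hoare0 X) :
    exists C, ~ Acc (@hoare0_lt X) B -> ~ Acc (@hoare0_lt X) C /\ hoare0_lt C B.
  have [aB|nB] := pselect (Acc (@hoare0_lt X) B); first by exists B.
  apply: contrapT => noC; apply: nB; constructor => C CB.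
  by apply: contrapT => nC; apply: noC; exists C.
pose g B := sval (cid (step B)).
have gP B : ~ Acc (@hoare0_lt X) B ->
    ~ Acc (@hoare0_lt X) (g B) /\ hoare0_lt (g B) B.
  by rewrite /g; case: cid.
pose a n := iter n g A.
have na n : ~ Acc (@hoare0_lt X) (a n).
  by elim: n => //= n /gP[].
have ltS n : hoare0_lt (a n.+1) (a n) by have [] := gP _ (na n).
have le_a n m : (n <= m)%N -> sval (a m) `<=` sval (a n).
  move=> /subnK<-; elim: (m - n)%N => [//|k IHk].
  by rewrite addSn; apply: subset_trans IHk; have [] := ltS (k + n)%N.
pose f n := ~` sval (a n).
have fo n : open (f n) by apply: closed_openC; exact: svalP (a n).
have Uo : open (\bigcup_n f n) by exact: bigcup_open.
have [|D _ UD] := @nX _ Uo nat setT f (fun n _ => fo n); first by [].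
pose N := \max_(n <- D) n.
have [_] := ltS N; apply => x aNx; apply: contrapT => nx.
have [n /= nD] : cover [set` D] f x by apply: UD; exists N.+1.
by apply; apply: le_a aNx; rewrite /N; exact: leq_bigmax_seq.
Qed.

Lemma rank_accE (P : Type) (lt : P -> P -> Prop) (x : P) (ax ax' : Acc lt x) :
  ole (rank_acc ax) (rank_acc ax').
Proof.
have Ax := ax; elim: Ax ax ax' => {}x _ IHx [ax] [ax'] /= [y yx].
by exists (exist _ y yx); exact: IHx.
Qed.

Lemma rank_le_stature (X : topologicalType) (A : hoare0 X) :
  noetherian X -> ole (rank (@hoare0_lt X) A) (stature X).
Proof.
move=> nX; rewrite /stature /rank.
case: pselect => [aA|/(_ (noetherian_wf nX A))//].
case: pselect => [aT|/(_ (noetherian_wf nX _))//].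
case: aA aT => aA [aT] /= [B BA].
have BT : hoare0_lt B (hoare0_top X).
  by split=> // TB; have [_] := BA; apply => x _; exact: TB.
by exists (exist _ B BT); exact: rank_accE.
Qed.

Lemma ordinal_rank_stature (X : topologicalType) :
  noetherian X -> ordinal_rank (@hoare0_lt X) =ord osucc (stature X).
Proof.
move=> nX; split=> [A|_]; first by exists tt; exact: rank_le_stature.
by exists (hoare0_top X); exact: ole_refl.
Qed.

(* Main.v *)
Require Import Defs.
From mathcomp Require Import all_boot finmap multiset.
From mathcomp Require Import all_classical.
From mathcomp Require Import topology.

(** Write ||Y|| for the stature of a subset Y of a space, that is, the rank of
    Y among the traces on Y of the closed sets.  Working with arbitrary subsets
    makes it possible to cut spaces into pieces.  If C is closed, then
      ||Y & C|| + ||Y - C|| <= ||Y|| <= ||Y & C|| (+) ||Y - C||,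
    where (+) is the natural sum ([sge_oadd], [sle_setU]).  Let b be at most
    every exponent of the Cantor normal form of r.  Then r (+) d = r + d for
    every d < omega ^ b, and it follows that a set of stature at least
    r + omega ^ b is cut by some closed set into a part of stature r and a
    part of stature at least omega ^ b ([sge_split]).

    The multisets are described by the sets [multiset_product F Cs], whose
    elements are a multiset over F plus one element of each set of the list Cs.
    An open neighbourhood of a multiset x_1, ..., x_n contains, for some open
    sets U_i around the x_i, every multiset that has n distinct entries lying
    in U_1, ..., U_n respectively ([closed_nbhs]).

    Upper bound ([multiset_product_ole]).  If F has stature
    omega ^ a_1 + ... + omega ^ a_m and the set C_i of Cs has stature at most
    omega ^ c_i, then the product has stature at most omega ^ E, where
      E = omega ^ circ a_1 + ... + omega ^ circ a_m (+) c_1 (+) ... (+) c_n.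
    The proof is an induction on E.  A closed set that misses a point of the
    product misses a basic neighbourhood U of it, so each of its members misses
    U either in the entry from some C_i, or in the part over F.  In the first
    case the stature of C_i drops.  In the second case some open set V has
    boundedly many entries of the part over F, which is therefore a multiset
    over F - V plus fewer than p elements of F & V.  As
    ||F - V|| + ||F & V|| <= ||F||, there is a term omega ^ g of the normal
    form of ||F|| such that F - V loses this term and F & V is a finite union
    of sets of stature at most omega ^ g.  These cost at most p - 1 new terms
    g in the exponent, which the lost term omega ^ circ g absorbs because
    g < omega ^ circ g ([hat_seq_lt]).  This inequality is where circ comes
    from: g < omega ^ g fails precisely when g is critical.  In both cases the
    closed set is covered by finitely many products of smaller exponent, and
    finite unions preserve statures below omega ^ E.

    Lower bound ([grows_all]).  Let Z lie in an open set disjoint from F and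
    have stature at least omega ^ b.  Passing from F to F | Z multiplies the
    stature of the space of multisets by at least omega ^ (omega ^ circ b).
    The whole statement follows by cutting X along its Cantor normal form
    ([sge_multisets_sum]).  The case of b reduces by the same cutting to
    smaller exponents, except for b = 0, where one counts the entries in Z
    ([sge_multisets_point]), and for b critical, where circ b is larger than
    what the smaller exponents give.  In the latter case the multisets with exactly k entries in Z
    already have stature at least ||multisets over F|| * omega ^ (b * k)
    ([sge_multiset_product]): let a closed set C sweep Z, allow one of the k
    entries to be in C, and note that each time that C grows, what is new
    contains a copy of the multisets with k - 1 entries in Z - C, whose stature
    is still at least omega ^ b. *)

Set Implicit Arguments.
Unset Strict Implicit.
Unset Printing Implicit Defensive.

Local Open Scope classical_set_scope.
Local Open Scope ord_scope.

(** * The order of ordinals *)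

Definition olt (a b : Ord) : Prop := ole (osucc a) b.

Local Notation "a <=o b" := (ole a b) (at level 70).
Local Notation "a <o b" := (olt a b) (at level 70).

Lemma olt_sup K (f : K -> Ord) b : b <o osup f <-> exists i, b <=o f i.
Proof. by split=> [/(_ tt)|h []]. Qed.

Lemma sup_ole K (f : K -> Ord) b : osup f <=o b <-> forall i, f i <o b.
Proof.
case: b => L g; split=> [h i|h i]; first by apply/olt_sup; exact: h.
by have /olt_sup := h i.
Qed.

Lemma olt_ole_trans b a c : a <o b -> b <=o c -> a <o c.
Proof. exact: ole_trans. Qed.

Lemma osucc_ole a b : a <=o b -> osucc a <=o osucc b.
Proof. by move=> ab []; exists tt. Qed.

Lemma ole_olt_trans b a c : a <=o b -> b <o c -> a <o c.
Proof. by move=> ab; apply: ole_trans; exact: osucc_ole. Qed.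

Lemma olt_succ a : a <o osucc a.
Proof. exact: ole_refl. Qed.

Lemma oltS a b : a <o osucc b <-> a <=o b.
Proof. by rewrite /osucc olt_sup; split=> [[_]|]; last by exists tt. Qed.

Lemma ole_succ a : a <=o osucc a.
Proof.
elim: a => K f IHf; apply/sup_ole => i; apply/oltS.
by apply: ole_trans (IHf i) _; apply/olt_sup; exists i; exact: ole_refl.
Qed.

Lemma oltW a b : a <o b -> a <=o b.
Proof. exact/ole_trans/ole_succ. Qed.

Lemma olt_trans b a c : a <o b -> b <o c -> a <o c.
Proof. by move=> ab /oltW; exact: olt_ole_trans. Qed.

Lemma ole_total a b : a <=o b \/ b <o a.
Proof.
elim: a b => K f IHf; elim=> L g IHg.
have [h|/existsNP[i h]] := pselect (forall i, f i <o osup g).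
  by left; apply/sup_ole.
right; apply/olt_sup; exists i; apply/sup_ole => j.
have [fg|//] := IHf i (g j).
by case: h; apply/olt_sup; exists j.
Qed.

Lemma oltNge a b : a <o b -> ~ b <=o a.
Proof.
elim: a b => K f IHf b /olt_ole_trans lt /lt/olt_sup[i fi].
by apply: IHf fi; apply/olt_sup; exists i; exact: ole_refl.
Qed.

Lemma olt_irr a : ~ a <o a.
Proof. by move=> /oltNge; apply; exact: ole_refl. Qed.

Lemma oleNgt a b : ~ a <=o b -> b <o a.
Proof. by have [] := ole_total a b. Qed.

Lemma olt_ind (P : Ord -> Prop) :
  (forall a, (forall b, b <o a -> P b) -> P a) -> forall a, P a.
Proof.
move=> h a; suff: forall b, b <=o a -> P b by apply; exact: ole_refl.
elim: a => K f IHf b bf; apply: h => c cb.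
by have /olt_sup[i] := olt_ole_trans cb bf; exact: IHf.
Qed.

Lemma ole_lt a b : (forall x, x <o a -> x <o b) -> a <=o b.
Proof.
by case: a => K f h; apply/sup_ole => i; apply: h; apply/olt_sup; exists i; exact: ole_refl.
Qed.

Lemma ole0 a : ozero <=o a.
Proof. by apply/sup_ole => -[]. Qed.

Lemma olt0 a : ~ a <o ozero.
Proof. by move=> /olt_sup[[]]. Qed.

Lemma ole_zero_or a : a <=o ozero \/ ozero <o a.
Proof. exact: ole_total. Qed.

Lemma oeq_refl a : a =ord a.
Proof. by split; exact: ole_refl. Qed.

Lemma oeq_sym a b : a =ord b -> b =ord a.
Proof. by case. Qed.

Lemma oeq_trans b a c : a =ord b -> b =ord c -> a =ord c.
Proof. by move=> [? ?] [? ?]; split; apply: (@ole_trans _ b). Qed.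

Lemma oleast (P : Ord -> Prop) a :
  P a -> exists2 b, P b & forall c, P c -> b <=o c.
Proof.
elim/olt_ind: a => a IH Pa.
have [h|/existsNP[c /not_implyP[Pc ac]]] := pselect (forall c, P c -> a <=o c).
  by exists a.
exact: IH (oleNgt ac) Pc.
Qed.

(** * Ordinal addition *)

Lemma olt_add_sup x a L (g : L -> Ord) :
  x <o oadd a (osup g) -> x <o a \/ exists j, x <=o oadd a (g j).
Proof.
case: a => K f /olt_sup[[i|j] h]; last by right; exists j.
by left; apply/olt_sup; exists i.
Qed.

Lemma oadd_lt_sup a L (g : L -> Ord) j : oadd a (g j) <o oadd a (osup g).
Proof. by case: a => K f; apply/olt_sup; exists (inr j); exact: ole_refl. Qed.

Lemma olt_addP x a b : x <o oadd a b -> x <o a \/ exists2 c, c <o b & x <=o oadd a c.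
Proof.
case: b => L g /olt_add_sup[|[j xj]]; [by left|right; exists (g j) => //].
by apply/olt_sup; exists j; exact: ole_refl.
Qed.

Lemma ole_addr a b : a <=o oadd a b.
Proof.
case: a b => K f [L g]; apply/sup_ole => i; apply/olt_sup.
by exists (inl i); exact: ole_refl.
Qed.

Lemma oadd_mono a a' b b' : a <=o a' -> b <=o b' -> oadd a b <=o oadd a' b'.
Proof.
elim: b b' => L g IHg b' aa' bb'; apply: ole_lt => x /olt_add_sup[xa|[j xj]].
  exact: olt_ole_trans xa (ole_trans aa' (ole_addr _ _)).
have /sup_ole/(_ j) := bb'; case: b' {bb'} => M h /olt_sup[k gh].
apply: ole_olt_trans xj (ole_olt_trans _ (oadd_lt_sup a' h k)); exact: IHg.
Qed.

Lemma oadd_monol b a a' : a <=o a' -> oadd a b <=o oadd a' b.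
Proof. by move=> h; apply: oadd_mono => //; exact: ole_refl. Qed.

Lemma oadd_monor a b b' : b <=o b' -> oadd a b <=o oadd a b'.
Proof. by apply: oadd_mono; exact: ole_refl. Qed.

Lemma oadd_ltr a b b' : b <o b' -> oadd a b <o oadd a b'.
Proof.
case: b' => L g /olt_sup[j bg].
exact: ole_olt_trans (oadd_monor a bg) (oadd_lt_sup a g j).
Qed.

Lemma oadd_ole a b x :
  a <=o x -> (forall c, c <o b -> oadd a c <o x) -> oadd a b <=o x.
Proof.
move=> ax h; apply: ole_lt => y /olt_addP[ya|[c cb yc]].
  exact: olt_ole_trans ya ax.
exact: ole_olt_trans yc (h _ cb).
Qed.

Lemma oadd_eq a a' b b' : a =ord a' -> b =ord b' -> oadd a b =ord oadd a' b'.
Proof. by move=> [? ?] [? ?]; split; exact: oadd_mono. Qed.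

Lemma oadda0 a : oadd a ozero =ord a.
Proof.
split; last exact: ole_addr.
by apply: oadd_ole => [|c /olt0//]; exact: ole_refl.
Qed.

Lemma oadd0a a : oadd ozero a =ord a.
Proof.
elim/olt_ind: a => a IH; split.
  apply: oadd_ole => [|c ca]; first exact: ole0.
  by apply: (ole_olt_trans _ ca); have [] := IH _ ca.
apply: ole_lt => x xa; apply: (ole_olt_trans _ (oadd_ltr ozero xa)).
by have [] := IH _ xa.
Qed.

Lemma ole_addl a b : b <=o oadd a b.
Proof. by have [_ /ole_trans] := oadd0a b; apply; apply: oadd_monol; exact: ole0. Qed.

Lemma oaddA a b c : oadd a (oadd b c) =ord oadd (oadd a b) c.
Proof.
elim/olt_ind: c => c IH; split.
  apply: oadd_ole => [|x /olt_addP[xb|[d dc xd]]].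
  - exact: ole_trans (ole_addr a b) (ole_addr _ _).
  - exact: olt_ole_trans (oadd_ltr a xb) (ole_addr _ _).
  - apply: ole_olt_trans (oadd_monor a xd) _.
    by apply: ole_olt_trans (oadd_ltr _ dc); have [] := IH _ dc.
apply: oadd_ole => [|d dc]; first exact/oadd_monor/ole_addr.
have [_ /ole_olt_trans] := IH _ dc; apply; do 2!apply: oadd_ltr.
exact: dc.
Qed.

Lemma oadd_succ a b : oadd a (osucc b) =ord osucc (oadd a b).
Proof.
split; last exact/oadd_ltr/olt_succ.
apply: oadd_ole => [|c /oltS cb]; first exact: ole_trans (ole_addr a b) (ole_succ _).
by apply/oltS/oadd_monor.
Qed.

Lemma oadd_cancel a b c : oadd a b <=o oadd a c -> b <=o c.
Proof.
move=> h; have [//|/(oadd_ltr a)/oltNge] := ole_total b c.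
by case.
Qed.

Lemma oadd_cancel_lt a b c : oadd a b <o oadd a c -> b <o c.
Proof. by move=> h; apply: oleNgt => /(oadd_monor a)/(oltNge h). Qed.

(** The difference is the least [c] such that [b <= a + c]. *)
Lemma osub a b : a <=o b -> exists c, b =ord oadd a c.
Proof.
move=> ab; have [c bc h] := @oleast (fun c => b <=o oadd a c) b (ole_addl a b).
exists c; split=> //; apply: oadd_ole => // d dc.
by apply: oleNgt => /h/(oltNge dc).
Qed.

(** * Finite multiples and ordinal multiplication *)

Lemma omuln_succ a n : omuln a n.+1 = oadd (omuln a n) a.
Proof. by []. Qed.

Lemma omuln_mono a b m n : a <=o b -> (m <= n)%N -> omuln a m <=o omuln b n.
Proof.
move=> ab /subnK<-; elim: (n - m)%N => [|k IHk].
  rewrite add0n; elim: m {n} => [|m IHm]; first exact: ole0.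
  by rewrite !omuln_succ; exact: oadd_mono.
by rewrite addSn omuln_succ; apply: ole_trans IHk (ole_addr _ _).
Qed.

Lemma omuln_ltS a n : ozero <o a -> omuln a n <o omuln a n.+1.
Proof.
move=> /(oadd_ltr (omuln a n)); apply: ole_olt_trans.
exact: ole_addr.
Qed.

Lemma omuln1 a : omuln a 1 =ord a.
Proof. exact: oadd0a. Qed.

Lemma omulnD a m n : omuln a (m + n) =ord oadd (omuln a m) (omuln a n).
Proof.
elim: n => [|n IHn]; first by rewrite addn0; apply: oeq_sym; exact: oadda0.
rewrite addnS !omuln_succ.
apply: (oeq_trans _ (oeq_sym (oaddA _ _ _))).
by apply: oadd_eq IHn (oeq_refl _).
Qed.

Lemma omulnS a n : omuln a n.+1 =ord oadd a (omuln a n).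
Proof.
have := omulnD a 1 n; rewrite add1n => h; apply: oeq_trans h _.
by apply: oadd_eq (omuln1 a) (oeq_refl _).
Qed.

Fixpoint omul (a b : Ord) {struct b} : Ord :=
  let: osup K f := a in
  let: osup L g := b in
  osup (fun k : L * K => oadd (omul a (g k.1)) (f k.2)).

Lemma olt_mul_sup x a L (g : L -> Ord) :
  x <o omul a (osup g) -> exists j d, d <o a /\ x <=o oadd (omul a (g j)) d.
Proof.
case: a => K f /olt_sup[[j i] h]; exists j, (f i); split=> //.
by apply/olt_sup; exists i; exact: ole_refl.
Qed.

Lemma omul_lt_sup a L (g : L -> Ord) j d :
  d <o a -> oadd (omul a (g j)) d <o omul a (osup g).
Proof.
case: a => K f /olt_sup[i di]; apply/olt_sup; exists (j, i).
exact: oadd_monor.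
Qed.

Lemma olt_mulP x a b :
  x <o omul a b -> exists c d, [/\ c <o b, d <o a & x <=o oadd (omul a c) d].
Proof.
case: b => L g /olt_mul_sup[j [d [da xd]]].
by exists (g j), d; split=> //; apply/olt_sup; exists j; exact: ole_refl.
Qed.

Lemma omul_mono a b b' : b <=o b' -> omul a b <=o omul a b'.
Proof.
elim: b b' => L g IHg b' bb'; apply: ole_lt => x /olt_mul_sup[j [d [da xd]]].
have /sup_ole/(_ j) := bb'; case: b' {bb'} => M h /olt_sup[k gh].
apply: ole_olt_trans xd (ole_olt_trans _ (omul_lt_sup h k da)).
by apply: oadd_monol; exact: IHg.
Qed.

Lemma omul_lt a b c d : c <o b -> d <o a -> oadd (omul a c) d <o omul a b.
Proof.
case: b => L g /olt_sup[j cg] /(omul_lt_sup g j); apply: ole_olt_trans.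
by apply: oadd_monol; exact: omul_mono.
Qed.

Lemma omul_succ a b : omul a (osucc b) =ord oadd (omul a b) a.
Proof.
split.
  apply: ole_lt => x /olt_mulP[c [d [/oltS cb da xcd]]].
  apply: ole_olt_trans xcd _; apply: olt_ole_trans (oadd_ltr _ da) _.
  exact/oadd_monol/omul_mono.
apply: oadd_ole => [|c ca]; first exact/omul_mono/ole_succ.
exact: omul_lt (olt_succ _) ca.
Qed.

Lemma omula0 a : omul a ozero =ord ozero.
Proof. by split; [apply: ole_lt => x /olt_mulP[c [d [/olt0]]]|exact: ole0]. Qed.

Lemma omulDr a b c : omul a (oadd b c) =ord oadd (omul a b) (omul a c).
Proof.
elim/olt_ind: c => c IH; split.
  apply: ole_lt => x /olt_mulP[e [d [/olt_addP[eb|[f fc ef]] da xed]]].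
    apply: ole_olt_trans xed _; apply: olt_ole_trans (ole_addr _ _).
    exact: omul_lt.
  apply: ole_olt_trans xed _.
  apply: (@ole_olt_trans (oadd (oadd (omul a b) (omul a f)) d)).
    apply: oadd_monol; apply: ole_trans (omul_mono _ ef) _.
    by have [] := IH _ fc.
  have [_ /ole_olt_trans] := oaddA (omul a b) (omul a f) d; apply.
  by apply: oadd_ltr; exact: omul_lt.
apply: oadd_ole => [|x /olt_mulP[e [d [ec da xed]]]]; first exact/omul_mono/ole_addr.
apply: ole_olt_trans (oadd_monor _ xed) _.
have [/ole_olt_trans + _] := oaddA (omul a b) (omul a e) d; apply.
have [_ h] := IH _ ec; apply: ole_olt_trans (oadd_monol d h) _.
by apply: omul_lt => //; exact: oadd_ltr.
Qed.

Lemma omul_omuln a b n : omul a (omuln b n) =ord omuln (omul a b) n.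
Proof.
elim: n => [|n IHn]; first exact: omula0.
rewrite !omuln_succ; apply: oeq_trans (omulDr _ _ _) _.
by apply: oadd_eq IHn (oeq_refl _).
Qed.

(** * Powers of omega *)

Lemma opow_gt0 a : ozero <o opow a.
Proof. by case: a => K f; apply/olt_sup; exists None; exact: ole0. Qed.

Lemma olt_powP x a :
  x <o opow a -> x <=o ozero \/ exists2 b, b <o a & exists n, x <=o omuln (opow b) n.
Proof.
case: a => K f /olt_sup[[[i n]|] h]; last by left.
right; exists (f i); first by apply/olt_sup; exists i; exact: ole_refl.
by exists n.
Qed.

Lemma opow_mono a b : a <=o b -> opow a <=o opow b.
Proof.
elim: a b => K f IHf b ab; apply/sup_ole => -[[i n]|]; last exact: opow_gt0.
move: ab => /sup_ole/(_ i); case: b => L g /olt_sup[j fg].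
by apply/olt_sup; exists (Some (j, n)); apply: omuln_mono (leqnn _); exact: IHf.
Qed.

Lemma omuln_opow_lt a b n : a <o b -> omuln (opow a) n <o opow b.
Proof.
case: b => L g /olt_sup[j ag]; apply/olt_sup; exists (Some (j, n)).
by apply: omuln_mono (leqnn _); exact: opow_mono.
Qed.

Lemma opow_lt a b : a <o b -> opow a <o opow b.
Proof.
move=> /(omuln_opow_lt 1); apply: ole_olt_trans.
by have [] := omuln1 (opow a).
Qed.

Lemma opow_eq a b : a =ord b -> opow a =ord opow b.
Proof. by move=> [? ?]; split; exact: opow_mono. Qed.

Lemma opow_lt_cancel a b : opow a <o opow b -> a <o b.
Proof. by move=> h; apply: oleNgt => /opow_mono/(oltNge h). Qed.

Lemma opow_ole e x :
  ozero <o x -> (forall b n, b <o e -> omuln (opow b) n <o x) -> opow e <=o x.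
Proof.
move=> x0 h; apply: ole_lt => y /olt_powP[y0|[b be [n yn]]].
  exact: ole_olt_trans y0 x0.
exact: ole_olt_trans yn (h _ _ be).
Qed.

Lemma ole_opow a : a <=o opow a.
Proof.
elim/olt_ind: a => a IH; apply: ole_lt => x xa.
exact: ole_olt_trans (IH _ xa) (opow_lt xa).
Qed.

Lemma opow0 : opow ozero =ord osucc ozero.
Proof.
split; last exact: (opow_gt0 ozero).
by apply: opow_ole => [|b n /olt0//]; exact: olt_succ.
Qed.

Lemma opow_add a b : opow (oadd a b) <=o omul (opow a) (opow b).
Proof.
elim/olt_ind: b => b IH.
have a1 : opow a <=o omul (opow a) (opow b).
  apply: ole_trans (omul_mono _ (opow_gt0 b)).
  have [_] := omul_succ (opow a) ozero; apply: ole_trans.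
  exact: ole_addl.
apply: opow_ole => [|c n /olt_addP[ca|[d db cd]]].
- exact: olt_ole_trans (opow_gt0 a) a1.
- exact: olt_ole_trans (omuln_opow_lt n ca) a1.
- apply: (@ole_olt_trans (omuln (omul (opow a) (opow d)) n)).
    apply: omuln_mono (leqnn _).
    exact: ole_trans (opow_mono cd) (IH _ db).
  have [_ /ole_olt_trans] := omul_omuln (opow a) (opow d) n; apply.
  have := omul_lt (omuln_opow_lt n db) (opow_gt0 a); apply: ole_olt_trans.
  exact: ole_addr.
Qed.

(** * The natural sum *)

(** The Hessenberg sum.  This recursion mirrors the way in which a closed set
    that is proper in a union of two sets is proper in one of them. *)
Fixpoint nadd (a : Ord) : Ord -> Ord :=
  let: osup K f := a in
  fix nadd_a (b : Ord) : Ord :=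
    let: osup L g := b in
    osup (fun k : K + L =>
            match k with inl i => nadd (f i) b | inr j => nadd_a (g j) end).

Lemma nadd_ltl a a' b : a <o a' -> nadd a b <o nadd a' b.
Proof.
suff le c c' d d' : c <=o c' -> d <=o d' -> nadd c d <=o nadd c' d'.
  case: a' => K f /olt_sup[i ai].
  apply: ole_olt_trans (le _ _ _ _ ai (ole_refl b)) _.
  by case: b => L g; apply/olt_sup; exists (inl i); exact: ole_refl.
elim: c d c' d' => K f IHf; elim=> L g IHg c' d' cc' dd'.
apply/sup_ole => -[i|j].
  have /sup_ole/(_ i) := cc'; case: c' cc' => K' f' cc' /olt_sup[i' ii'].
  apply: ole_olt_trans (IHf i _ _ _ ii' dd') _.
  by case: d' dd' => L' g' _; apply/olt_sup; exists (inl i'); exact: ole_refl.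
have /sup_ole/(_ j) := dd'; case: d' dd' => L' g' dd' /olt_sup[j' jj'].
apply: ole_olt_trans (IHg j _ _ cc' jj') _.
by case: c' cc' => K' f' _; apply/olt_sup; exists (inr j'); exact: ole_refl.
Qed.

Lemma nadd_mono a a' b b' : a <=o a' -> b <=o b' -> nadd a b <=o nadd a' b'.
Proof.
elim: a b a' b' => K f IHf; elim=> L g IHg a' b' aa' bb'.
apply/sup_ole => -[i|j].
  have /sup_ole/(_ i) h := aa'.
  exact: ole_olt_trans (IHf i _ _ _ (ole_refl _) bb') (nadd_ltl _ h).
have /sup_ole/(_ j) := bb'; case: b' bb' => L' g' bb' /olt_sup[j' jj'].
apply: ole_olt_trans (IHg j _ _ aa' jj') _.
by case: a' aa' => K' f' _; apply/olt_sup; exists (inr j'); exact: ole_refl.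
Qed.

Lemma nadd_ltr a b b' : b <o b' -> nadd a b <o nadd a b'.
Proof.
case: b' => L g /olt_sup[j bj].
apply: ole_olt_trans (nadd_mono (ole_refl a) bj) _.
by case: a => K f; apply/olt_sup; exists (inr j); exact: ole_refl.
Qed.

Lemma nadd_ole a b x :
  (forall c, c <o a -> nadd c b <o x) -> (forall c, c <o b -> nadd a c <o x) ->
  nadd a b <=o x.
Proof.
case: a b => K f [L g] ha hb; apply/sup_ole => -[i|j].
  by apply: ha; apply/olt_sup; exists i; exact: ole_refl.
by apply: hb; apply/olt_sup; exists j; exact: ole_refl.
Qed.

Lemma olt_naddP x a b : x <o nadd a b ->
  (exists2 c, c <o a & x <=o nadd c b) \/ (exists2 c, c <o b & x <=o nadd a c).
Proof.
case: a b => K f [L g] /olt_sup[[i|j] h]; [left; exists (f i)|right; exists (g j)] => //.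
  by apply/olt_sup; exists i; exact: ole_refl.
by apply/olt_sup; exists j; exact: ole_refl.
Qed.

Lemma nadd_comm_le a b : nadd a b <=o nadd b a.
Proof.
elim/olt_ind: a b => a IHa; elim/olt_ind => b IHb; apply: nadd_ole => c h.
  exact: ole_olt_trans (IHa _ h _) (nadd_ltr _ h).
exact: ole_olt_trans (IHb _ h) (nadd_ltl _ h).
Qed.

Lemma naddA_le a b c : nadd (nadd a b) c <=o nadd a (nadd b c).
Proof.
elim/olt_ind: a b c => a IHa; elim/olt_ind => b IHb; elim/olt_ind => c IHc.
apply: nadd_ole => x xab.
  have [[d da xd]|[d db xd]] := olt_naddP xab.
    apply: ole_olt_trans (nadd_mono xd (ole_refl c)) _.
    exact: ole_olt_trans (IHa _ da _ _) (nadd_ltl _ da).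
  apply: ole_olt_trans (nadd_mono xd (ole_refl c)) _.
  exact: ole_olt_trans (IHb _ db _) (nadd_ltr _ (nadd_ltl _ db)).
exact: ole_olt_trans (IHc _ xab) (nadd_ltr _ (nadd_ltr _ xab)).
Qed.

Lemma naddA_ge a b c : nadd a (nadd b c) <=o nadd (nadd a b) c.
Proof.
apply: ole_trans (nadd_comm_le _ _) _.
apply: ole_trans (nadd_mono (nadd_comm_le b c) (ole_refl a)) _.
apply: ole_trans (naddA_le _ _ _) _.
apply: ole_trans (nadd_comm_le _ _) _.
exact: nadd_mono (nadd_comm_le b a) (ole_refl c).
Qed.

Lemma nadda0 a : nadd a ozero <=o a.
Proof.
elim/olt_ind: a => a IH; apply: nadd_ole => [c ca|c /olt0//].
by apply: (ole_olt_trans _ ca); exact: IH.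
Qed.

Lemma nadd0a a : nadd ozero a <=o a.
Proof. exact: ole_trans (nadd_comm_le ozero a) (nadda0 a). Qed.

Lemma ole_naddr a b : a <=o nadd a b.
Proof.
elim/olt_ind: a => a IH; apply: ole_lt => x xa.
exact: ole_olt_trans (IH _ xa) (nadd_ltl _ xa).
Qed.

Lemma oadd_nadd a b : oadd a b <=o nadd a b.
Proof.
elim/olt_ind: b => b IH; apply: oadd_ole => [|c cb]; first exact: ole_naddr.
exact: ole_olt_trans (IH _ cb) (nadd_ltr _ cb).
Qed.

Definition nsum (s : seq Ord) : Ord := foldr nadd ozero s.

Lemma ole_naddl a b : b <=o nadd a b.
Proof. exact: ole_trans (ole_naddr _ _) (nadd_comm_le _ _). Qed.

Lemma nsum_cat s t : nsum (s ++ t) <=o nadd (nsum s) (nsum t).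
Proof.
elim: s => [|a s IHs]; first exact: ole_naddl.
exact: ole_trans (nadd_mono (ole_refl a) IHs) (naddA_ge _ _ _).
Qed.

(** * Natural sums and powers of omega *)

(** This holds when all exponents of the Cantor normal form of [r] are at least
    [c] ([nclosed_sum_opow]).  It is stated without normal forms so that it can
    be proved by induction on [r] and [c]. *)
Definition nclosed (c r : Ord) : Prop :=
  forall x d, x <o r -> d <o opow c -> nadd x d <o r.

Lemma nclosed_le c e r : c <=o e -> nclosed e r -> nclosed c r.
Proof.
by move=> ce h x d xr dc; apply: h => //; exact: olt_ole_trans dc (opow_mono ce).
Qed.

Lemma nclosed0 c : nclosed c ozero.
Proof. by move=> x d /olt0. Qed.

Lemma nclosed_nadd_oadd c r y d :
  nclosed c r -> d <o opow c -> nadd (oadd r y) d <=o oadd r (nadd y d).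
Proof.
move=> cr; elim/olt_ind: y d => y IHy; elim/olt_ind => d IHd dc.
apply: nadd_ole => [x /olt_addP[xr|[z zy xz]]|z zd].
- exact: olt_ole_trans (cr _ _ xr dc) (ole_addr _ _).
- apply: ole_olt_trans (nadd_mono xz (ole_refl d)) _.
  exact: ole_olt_trans (IHy _ zy _ dc) (oadd_ltr _ (nadd_ltl _ zy)).
- exact: ole_olt_trans (IHd _ zd (olt_trans zd dc)) (oadd_ltr _ (nadd_ltr _ zd)).
Qed.

(** Below [omega ^ c], the natural sum with [r] on the left coincides with the
    ordinary one: [oadd_nadd] is the reverse inequality. *)
Lemma nclosed_nadd c r d :
  nclosed c r -> d <o opow c -> nadd r d <=o oadd r d.
Proof.
move=> cr dc.
apply: ole_trans (nadd_mono (ole_addr r ozero) (ole_refl d)) _.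
apply: ole_trans (nclosed_nadd_oadd _ cr dc) (oadd_monor _ _).
exact: ole_trans (nadd_comm_le _ _) (nadda0 _).
Qed.

Lemma nclosed_oadd c r s : nclosed c r -> nclosed c s -> nclosed c (oadd r s).
Proof.
move=> cr cs x d /olt_addP[xr|[y ys xy]] dc.
  exact: olt_ole_trans (cr _ _ xr dc) (ole_addr _ _).
apply: ole_olt_trans (nadd_mono xy (ole_refl d)) _.
apply: ole_olt_trans (nclosed_nadd_oadd y cr dc) _.
by apply: oadd_ltr; exact: cs.
Qed.

Lemma nclosed_omuln c r n : nclosed c r -> nclosed c (omuln r n).
Proof.
move=> cr; elim: n => [|n IHn]; first exact: nclosed0.
by rewrite omuln_succ; exact: nclosed_oadd.
Qed.

(** An ordinal below [omega ^ b * m.+1] is at most [omega ^ b * m + z] with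
    [z < omega ^ b], and [nclosed_nadd] moves such a [z] to the end. *)
Lemma nadd_omuln_opow b m n : nclosed b (opow b) ->
  nadd (omuln (opow b) m) (omuln (opow b) n) <=o omuln (opow b) (m + n).
Proof.
move=> bb.
have step i j y : y <o omuln (opow b) i.+1 ->
    nadd (omuln (opow b) i) (omuln (opow b) j) <=o omuln (opow b) (i + j) ->
    nadd y (omuln (opow b) j) <o omuln (opow b) (i + j).+1.
  move=> yi IH.
  have [z zb yz] : exists2 z, z <o opow b & y <=o oadd (omuln (opow b) i) z.
    have [yi'|[z zb yz]] := olt_addP yi; last by exists z.
    exists ozero; first exact: opow_gt0.
    exact: ole_trans (oltW yi') (ole_addr _ _).
  apply: (@ole_olt_trans (oadd (omuln (opow b) (i + j)) z)); last first.
    by rewrite omuln_succ; exact: oadd_ltr.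
  apply: (ole_trans _ (nclosed_nadd (nclosed_omuln bb) zb)).
  apply: (ole_trans _ (nadd_comm_le _ _)); apply: (ole_trans _ (nadd_mono (ole_refl z) IH)).
  apply: (ole_trans _ (naddA_le _ _ _)); apply: nadd_mono (ole_refl _).
  exact: ole_trans (ole_trans yz (oadd_nadd _ _)) (nadd_comm_le _ _).
elim: m n => [n|m IHm]; first exact: ole_trans (nadd_comm_le _ _) (nadda0 _).
elim=> [|n IHn]; apply: nadd_ole => y yn.
- by rewrite addSn; exact: step.
- by case: (olt0 yn).
- by rewrite addSn; exact: step.
apply: ole_olt_trans (nadd_comm_le _ _) _.
rewrite addnC addSn; apply: step => //; rewrite addnC.
exact: ole_trans (nadd_comm_le _ _) IHn.
Qed.

(** Powers of omega are additively indecomposable for the natural sum. *)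
Lemma nclosed_opow c : nclosed c (opow c).
Proof.
elim/olt_ind: c => c IH x d xc dc.
have [x0|[b bc [m xb]]] := olt_powP xc.
  by apply: ole_olt_trans (nadd_mono x0 (ole_refl d)) (ole_olt_trans _ dc); exact: nadd0a.
have [d0|[e ec [n de]]] := olt_powP dc.
  by apply: ole_olt_trans (nadd_mono (ole_refl x) d0) (ole_olt_trans _ xc); exact: nadda0.
have [g [gc bg eg]] : exists g, [/\ g <o c, b <=o g & e <=o g].
  by have [be|/oltW eb] := ole_total b e; [exists e|exists b]; split=> //; exact: ole_refl.
apply: (ole_olt_trans _ (omuln_opow_lt (m + n) gc)).
apply: (ole_trans _ (nadd_omuln_opow _ _ (IH _ gc))).
apply: nadd_mono; [apply: ole_trans xb _|apply: ole_trans de _];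
  by apply: omuln_mono (leqnn _); exact: opow_mono.
Qed.

Lemma nadd_opow_lt a b c : a <o opow c -> b <o opow c -> nadd a b <o opow c.
Proof. exact: nclosed_opow. Qed.

Lemma oadd_opow_lt a b c : a <o opow c -> b <o opow c -> oadd a b <o opow c.
Proof. by move=> ac bc; apply: ole_olt_trans (oadd_nadd _ _) (nadd_opow_lt ac bc). Qed.

(** * Cantor normal forms *)

(** A [Prop]-valued predicate, as the order on [Ord] is not boolean. *)
Fixpoint for_all (T : Type) (P : T -> Prop) (s : seq T) : Prop :=
  if s is x :: s' then P x /\ for_all P s' else True.

Lemma for_all_cat T (P : T -> Prop) s t :
  for_all P (s ++ t) <-> for_all P s /\ for_all P t.
Proof. by elim: s => /= [|x s ->]; tauto. Qed.

Lemma for_all_impl T (P Q : T -> Prop) s :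
  (forall x, P x -> Q x) -> for_all P s -> for_all Q s.
Proof. by move=> PQ; elim: s => //= x s IHs [/PQ ? /IHs]. Qed.

Lemma for_all_nseq T (P : T -> Prop) n x : P x -> for_all P (nseq n x).
Proof. by move=> Px; elim: n. Qed.

Lemma for_all_map T U (f : T -> U) (P : U -> Prop) s :
  for_all P (map f s) <-> for_all (fun x => P (f x)) s.
Proof. by elim: s => //= x s ->. Qed.

Lemma nonincreasing_all a s : nonincreasing a s -> for_all (fun b => b <=o a) s.
Proof.
elim: s a => //= b s IHs a [ba /IHs bs]; split=> //.
by apply: for_all_impl bs => c cb; exact: ole_trans cb ba.
Qed.

Lemma nonincreasing_le a b s : a <=o b -> nonincreasing a s -> nonincreasing b s.
Proof. by case: s => //= c s ab [ca]; split=> //; exact: ole_trans ca ab. Qed.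

Lemma nonincreasing_cat a s b t :
  for_all (fun c => b <=o c) s -> nonincreasing a s -> b <=o a -> nonincreasing b t ->
  nonincreasing a (s ++ t).
Proof.
elim: s a => /= [a _ _ ba|c s IHs a [bc bs] [ca cs] _ bt].
  exact: nonincreasing_le.
by split=> //; exact: IHs.
Qed.

Lemma nonincreasing_catP a s b t : nonincreasing a (s ++ b :: t) ->
  [/\ nonincreasing a s, for_all (fun c => b <=o c) s, b <=o a & nonincreasing b t].
Proof.
elim: s a => /= [a [ba bt]|c s IHs a [ca /IHs[cs bs bc bt]]]; first by [].
by split=> //; exact: ole_trans bc ca.
Qed.

Lemma sum_opow_cat s t : sum_opow (s ++ t) =ord oadd (sum_opow s) (sum_opow t).
Proof.
elim: s => [|a s IHs]; first by apply: oeq_sym; exact: oadd0a.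
apply: (oeq_trans _ (oaddA _ _ _)).
exact: oadd_eq (oeq_refl _) IHs.
Qed.

Lemma sum_opow_nseq n a : sum_opow (nseq n a) =ord omuln (opow a) n.
Proof.
elim: n => [|n IHn]; first exact: oeq_refl.
apply: (oeq_trans _ (oeq_sym (omulnS _ _))).
exact: oadd_eq (oeq_refl _) IHn.
Qed.

Lemma sum_opow_ole g s :
  for_all (fun b => b <=o g) s -> sum_opow s <=o omuln (opow g) (size s).
Proof.
elim: s => [_|b s IHs]; first exact: ole0.
move=> [bg /IHs h] /=; have [_] := omulnS (opow g) (size s); apply: ole_trans.
exact: oadd_mono (opow_mono bg) h.
Qed.

Lemma sum_opow_lt g s : for_all (fun b => b <o g) s -> sum_opow s <o opow g.
Proof.
elim: s => [_|b s IHs]; first exact: opow_gt0.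
by move=> [bg /IHs h]; apply: oadd_opow_lt (opow_lt bg) h.
Qed.

Lemma nclosed_sum_opow c s : for_all (fun b => c <=o b) s -> nclosed c (sum_opow s).
Proof.
elim: s => [_|b s IHs]; first exact: nclosed0.
by move=> [cb /IHs]; apply: nclosed_oadd; exact: nclosed_le cb (@nclosed_opow b).
Qed.

Lemma olt_omuln_div a c n : a <o omuln c n.+1 ->
  exists m, exists2 r, a =ord oadd (omuln c m) r & r <o c.
Proof.
elim: n => [|n IHn] an.
  exists 0, a; first exact: oeq_sym (oadd0a _).
  by apply: (olt_ole_trans an _); have [] := omuln1 c.
have [|/IHn//] := ole_total (omuln c n.+1) a.
move=> /osub[r ar]; exists n.+1, r => //.
apply: (@oadd_cancel_lt (omuln c n.+1)).
by case: ar => _ /ole_olt_trans; apply.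
Qed.

(** The leading exponent [c] is found from the least [e] with [a < omega ^ e]:
    then [omega ^ c <= a <= omega ^ c * n] for some [c < e].  Dividing by
    [omega ^ c] leaves a remainder below [omega ^ c], hence below [a]. *)
Lemma cnf_exists a : exists s, is_cnf a s.
Proof.
elim/olt_ind: a => a IH.
have [a0|a0] := ole_zero_or a.
  by exists [::]; split=> //; split=> //; exact: ole0.
have [e ae e_min] := @oleast (fun e => a <o opow e) (osucc a)
  (ole_olt_trans (ole_opow a) (opow_lt (olt_succ a))).
have [/oltNge//|[c ce [n an]]] := olt_powP ae.
have ca : opow c <=o a.
  by have [//|/e_min/(oltNge ce)] := ole_total (opow c) a.
have [|m [r amr rc]] := @olt_omuln_div a (opow c) n.
  exact: ole_olt_trans an (omuln_ltS _ (opow_gt0 _)).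
have [t [rt rE]] := IH _ (olt_ole_trans rc ca).
exists (nseq m c ++ t); split.
  have ca' : c <=o a by exact: ole_trans (ole_opow c) ca.
  apply: (@nonincreasing_cat _ _ c) => //.
  - by apply: for_all_nseq; exact: ole_refl.
  - by case: m {amr} => //= m; split=> //; elim: m => //= m ?; split=> //; exact: ole_refl.
  case: t rt rE => //= b t [_ bt] rE; split=> //.
  apply/oltW/opow_lt_cancel; apply: (ole_olt_trans _ rc).
  by case: rE => _; apply: ole_trans; exact: ole_addr.
apply: oeq_trans amr _; apply: oeq_sym; apply: oeq_trans (sum_opow_cat _ _) _.
exact: oadd_eq (sum_opow_nseq _ _) (oeq_sym rE).
Qed.

Lemma cnfP a : is_cnf a (cnf a).
Proof. exact: ClassicalEpsilon.epsilon_spec (cnf_exists a). Qed.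

Lemma cnf_lt c a s : a <o opow c -> is_cnf a s -> for_all (fun b => b <o c) s.
Proof.
move=> ac [_]; elim: s a ac => //= b s IHs a ac [ba ab].
have bs_c : oadd (opow b) (sum_opow s) <o opow c by exact: ole_olt_trans ab ac.
split.
  by apply: opow_lt_cancel; exact: ole_olt_trans (ole_addr _ _) bs_c.
apply: (IHs (sum_opow s)); last exact: oeq_refl.
exact: ole_olt_trans (ole_addl _ _) bs_c.
Qed.

(** An ordinal below a Cantor normal form agrees with it up to some term
    [omega ^ g], and its remainder is below this term. *)
Lemma olt_sum_opow x s : x <o sum_opow s -> exists p g q d,
  [/\ s = p ++ g :: q, x =ord oadd (sum_opow p) d & d <o opow g].
Proof.
elim: s x => [x /olt0//|a s IHs x /= xas].
have [/osub[y xy]|xa] := ole_total (opow a) x; last first.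
  by exists [::], a, s, x; split=> //; apply: oeq_sym; exact: oadd0a.
have /IHs[p [g [q [d [-> yd dg]]]]] : y <o sum_opow s.
  by apply: (@oadd_cancel_lt (opow a)); case: xy => _ /ole_olt_trans; apply.
exists (a :: p), g, q, d; split=> //.
apply: oeq_trans xy _; apply: (oeq_trans _ (oaddA _ _ _)).
exact: oadd_eq (oeq_refl _) yd.
Qed.

(** * The operations circ and hat *)

Lemma critical_eq a b : a =ord b -> critical a -> critical b.
Proof.
move=> ab ca; apply: oeq_trans (oeq_sym ab) _; apply: oeq_trans ca _.
exact: opow_eq.
Qed.

Definition near_critical a := exists e n, critical e /\ a =ord oadd e (onat n).

Lemma circ_near a : near_critical a -> circ a = osucc a.
Proof. by rewrite /circ; case: pselect. Qed.

Lemma circ_far a : ~ near_critical a -> circ a = a.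
Proof. by rewrite /circ; case: pselect. Qed.

Lemma near_critical_eq a b : a =ord b -> near_critical a -> near_critical b.
Proof.
move=> ab [e [n [ce an]]]; exists e, n; split=> //.
exact: oeq_trans (oeq_sym ab) an.
Qed.

Lemma near_critical_succ a : near_critical a -> near_critical (osucc a).
Proof.
move=> [e [n [ce [an na]]]]; exists e, n.+1; split=> //.
apply: (@oeq_trans (osucc (oadd e (onat n)))); first by split; exact: osucc_ole.
by apply: oeq_sym; exact: oadd_succ.
Qed.

Lemma critical_near a : critical a -> near_critical a.
Proof. by move=> ca; exists a, 0; split=> //; apply: oeq_sym; exact: oadda0. Qed.

Lemma ole_circ a : a <=o circ a.
Proof.
have [/circ_near->|/circ_far->] := pselect (near_critical a); first exact: ole_succ.
exact: ole_refl.
Qed.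

(** Only the case where [a] is shifted and [b = a + 1] is not immediate; then
    [b] is a finite successor of the same critical ordinal and is shifted too. *)
Lemma circ_lt a b : a <o b -> circ a <o circ b.
Proof.
move=> ab; have [na|/circ_far->] := pselect (near_critical a); last first.
  exact: olt_ole_trans ab (ole_circ b).
rewrite (circ_near na); have [ba|h] := ole_total b (osucc a).
  by rewrite circ_near //; apply: near_critical_eq (near_critical_succ na).
exact: olt_ole_trans h (ole_circ b).
Qed.

Lemma circ_mono a b : a <=o b -> circ a <=o circ b.
Proof.
move=> ab; have [ba|/circ_lt/oltW//] := ole_total b a.
have [na|/circ_far->] := pselect (near_critical a); last first.
  exact: ole_trans ab (ole_circ b).
have nb : near_critical b by exact: near_critical_eq na.
by rewrite !circ_near //; exact: osucc_ole.
Qed.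

(** The purpose of [circ]: [a < omega ^ a] fails exactly at the critical
    ordinals, and these are shifted. *)
Lemma olt_opow_circ a : a <o opow (circ a).
Proof.
have [ca|aa] := ole_total (opow a) a.
  have /critical_near/circ_near-> : critical a by split=> //; exact: ole_opow.
  exact: ole_olt_trans (ole_opow a) (opow_lt (olt_succ a)).
exact: olt_ole_trans aa (opow_mono (ole_circ a)).
Qed.

Definition hat_seq (s : seq Ord) : Ord := sum_opow (map circ s).

(** The exponent for the upper bound decreases when the term [omega ^ g] and all
    later ones are traded for smaller terms and finitely many copies of [g],
    since everything that is gained remains below [omega ^ circ g]. *)
Lemma hat_seq_lt a p g q t k :
  nonincreasing a (p ++ g :: q) -> for_all (fun b => b <o g) t ->
  nadd (hat_seq (p ++ t)) (nsum (nseq k g)) <o hat_seq (p ++ g :: q).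
Proof.
move=> /nonincreasing_catP[_ gp _ _] tg; rewrite /hat_seq !map_cat /=.
set R := map circ p; set T := map circ t.
have Rg : nclosed (circ g) (sum_opow R).
  apply: nclosed_sum_opow; apply/for_all_map.
  exact: for_all_impl (fun b => @circ_mono g b) gp.
have Tg : sum_opow T <o opow (circ g).
  by apply: sum_opow_lt; apply/for_all_map; exact: for_all_impl (fun b => @circ_lt b g) tg.
have kg : nsum (nseq k g) <o opow (circ g).
  elim: k => [|k IHk]; first exact: opow_gt0.
  exact: nadd_opow_lt (olt_opow_circ _) IHk.
have [RT _] := sum_opow_cat R T.
apply: ole_olt_trans (nadd_mono RT (ole_refl _)) _.
apply: ole_olt_trans (nclosed_nadd_oadd _ Rg kg) _.
have [_ /(olt_ole_trans _)] := sum_opow_cat R (circ g :: map circ q); apply.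
apply: oadd_ltr; apply: (olt_ole_trans _ (ole_addr _ _)).
exact: nadd_opow_lt.
Qed.
(** * The stature of a subset of a topological space *)

Section Subsets.
Variable T : topologicalType.
Implicit Types (Y Z C : set T) (a b : Ord).

(** [sle Y a] and [sge Y a] say that the stature of [Y] is at most, respectively
    at least, [a].  These bounds make sense when [Y] is not known to be
    Noetherian; an upper bound even implies well-foundedness ([sle_Acc]), so
    that the space of multisets need not be shown Noetherian beforehand. *)
Fixpoint sle (Y : set T) (a : Ord) {struct a} : Prop :=
  let: osup K f := a in
  forall C, closed C -> ~ Y `<=` C -> exists i, sle (Y `&` C) (f i).

Fixpoint sge (Y : set T) (a : Ord) {struct a} : Prop :=
  let: osup K f := a in
  forall i, exists C, [/\ closed C, ~ Y `<=` C & sge (Y `&` C) (f i)].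

Definition sgt Y a : Prop := exists C, [/\ closed C, ~ Y `<=` C & sge (Y `&` C) a].

Lemma sle_le Y a b : a <=o b -> sle Y a -> sle Y b.
Proof.
elim: a b Y => K f IHf [L g] Y fg Yf C cC YC.
have [i Yi] := Yf C cC YC; have [j fgj] := fg i.
by exists j; exact: IHf fgj Yi.
Qed.

Lemma sge_le Y a b : a <=o b -> sge Y b -> sge Y a.
Proof.
elim: a b Y => K f IHf [L g] Y fg Yg i.
have [j fgj] := fg i; have [C [cC YC Yj]] := Yg j.
by exists C; split=> //; exact: IHf fgj Yj.
Qed.

Lemma sleP Y a :
  sle Y a <-> forall C, closed C -> ~ Y `<=` C -> exists2 b, b <o a & sle (Y `&` C) b.
Proof.
case: a => K f; split=> h C cC /(h C cC) => [[i Yi]|[b /olt_sup[i bi] Yb]].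
  by exists (f i) => //; apply/olt_sup; exists i; exact: ole_refl.
by exists i; exact: sle_le Yb.
Qed.

Lemma sgeP Y a : sge Y a <-> forall b, b <o a -> sgt Y b.
Proof.
case: a => K f; split=> [h b /olt_sup[i bi]|h i]; last first.
  by apply: h; apply/olt_sup; exists i; exact: ole_refl.
have [C [cC YC Yi]] := h i.
by exists C; split=> //; exact: sge_le Yi.
Qed.

Lemma sle_sub Z Y a : Z `<=` Y -> sle Y a -> sle Z a.
Proof.
elim: a Z Y => K f IHf Z Y ZY Yf C cC ZC.
have [|i Yi] := Yf C cC; first by move=> YC; apply: ZC => x /ZY/YC.
by exists i; apply: IHf Yi; exact: setSI.
Qed.

Lemma sge_sub Z Y a : Z `<=` Y -> sge Z a -> sge Y a.
Proof.
elim: a Z Y => K f IHf Z Y ZY Zf i; have [C [cC ZC Zi]] := Zf i.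
exists C; split=> //; first by move=> YC; apply: ZC => x /ZY/YC.
by apply: IHf Zi; exact: setSI.
Qed.

Lemma sgt_sge Y a : sgt Y a -> sge Y a.
Proof. by move=> [C [_ _]]; apply: sge_sub; exact: subIsetl. Qed.

Lemma sgt_sge_succ Y a : sgt Y a <-> sge Y (osucc a).
Proof. by split=> [h []|/(_ tt)]. Qed.

Lemma sge_sle Y a b : sge Y a -> sle Y b -> a <=o b.
Proof.
elim: a b Y => K f IHf [L g] Y Yf Yg; apply/sup_ole => i.
have [C [cC YC Yi]] := Yf i; have [j Yj] := Yg C cC YC.
by apply/olt_sup; exists j; exact: IHf Yi Yj.
Qed.

Lemma sge0 Y : sge Y ozero.
Proof. by case. Qed.

Lemma sge1 Y x : Y x -> sge Y (osucc ozero).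
Proof.
move=> Yx []; exists set0; split; [exact: closed0|by move=> /(_ x Yx)|exact: sge0].
Qed.

(** The two bounds are complementary: negating one recursion gives the other. *)
Lemma sle_or_sgt Y a : sle Y a \/ sgt Y a.
Proof.
elim: a Y => K f IHf Y; have [|/existsNP[C]] := pselect (sle Y (osup f)); first by left.
move=> /not_implyP[cC /not_implyP[YC /forallNP noi]]; right.
by exists C; split=> // i; have [/noi|] := IHf i (Y `&` C).
Qed.

(** A closed set that does not contain [Y | Z] misses a point of [Y] or of [Z],
    so that one of the two summands decreases. *)
Lemma sle_setU Y Z a b : sle Y a -> sle Z b -> sle (Y `|` Z) (nadd a b).
Proof.
elim/olt_ind: a b Y Z => a IHa; elim/olt_ind => b IHb Y Z /sleP Ya /sleP Zb.
apply/sleP => C cC YZC; rewrite setIUl.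
have [YC|YC] := pselect (Y `<=` C); last first.
  have [d da Yd] := Ya C cC YC; exists (nadd d b); first exact: nadd_ltl.
  by apply: IHa => //; apply: sle_sub (@subIsetl _ Z C) _; apply/sleP.
have [|d db Zd] := Zb C cC; first by move=> ZC; apply: YZC => x [/YC|/ZC].
exists (nadd a d); first exact: nadd_ltr.
by apply: IHb => //; apply: sle_sub (@subIsetl _ Y C) _; apply/sleP.
Qed.

(** Climb first through the closed subsets of [Y & C], then through the unions
    of [Y & C] with the closed subsets of [Y - C]. *)
Lemma sge_oadd Y C a b :
  closed C -> sge (Y `&` C) a -> sge (Y `\` C) b -> sge Y (oadd a b).
Proof.
move=> cC Ya; elim/olt_ind: b Y Ya => b IHb Y Ya Yb; apply/sgeP => x.
case/olt_addP=> [xa|[d db xd]].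
  have /sgeP/(_ _ xa)[D [cD YD h]] := Ya.
  exists (C `&` D); rewrite setIA; split=> //; first exact: closedI.
  by move=> YCD; apply: YD => y [/YCD[]].
have /sgeP/(_ _ db)[D [cD YD h]] := Yb.
exists (C `|` D); split; first exact: closedU.
  by move=> YCD; apply: YD => y [/YCD[]].
apply: sge_le xd _; apply: IHb => //.
  by apply: sge_sub Ya => y [Yy Cy]; do !split=> //; left.
by apply: sge_sub h => y [[Yy nCy] Dy]; do !split=> //; right.
Qed.

Lemma sle_setD Y C a b :
  closed C -> sge (Y `&` C) a -> sle Y (oadd a b) -> sle (Y `\` C) b.
Proof.
move=> cC Ya Yab; have [//|/sgt_sge_succ/(sge_oadd cC Ya)] := sle_or_sgt (Y `\` C) b.
by move=> /sge_sle/(_ Yab)/oadd_cancel/olt_irr.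
Qed.

Lemma sge_setD Y C a b e : sge Y e -> sle (Y `&` C) a ->
  (forall d, d <o b -> nadd a d <o e) -> sge (Y `\` C) b.
Proof.
move=> Ye Ya h; apply/sgeP => d /h ade.
have [/(sle_setU Ya)|//] := sle_or_sgt (Y `\` C) d.
by rewrite setUIDK => /(sge_sle Ye)/(oltNge ade).
Qed.

(** An upper bound for the whole space replaces the Noetherian hypothesis. *)
Section Bounded.
Variable o : Ord.
Hypothesis oT : sle setT o.

(** Ranks take all smaller values. *)
Lemma sge_exact Y a : sge Y a ->
  exists C, [/\ closed C, sle (Y `&` C) a & sge (Y `&` C) a].
Proof.
have [b Yb] : exists b, sle Y b by exists o; exact: sle_sub oT.
elim/olt_ind: b Y Yb => b IHb Y Yb Ya.
have [Y_le|[C [cC YC YCa]]] := sle_or_sgt Y a.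
  by exists setT; rewrite setIT; split=> //; exact: closedT.
have /sleP/(_ C cC YC)[d db Yd] := Yb.
have [D [cD le ge]] := IHb _ db _ Yd YCa.
by exists (C `&` D); rewrite setIA; split=> //; exact: closedI.
Qed.

Lemma stature_exists Y : exists a, sle Y a /\ sge Y a.
Proof.
have [a Ya a_min] := @oleast (sle Y) o (sle_sub (@subsetT _ Y) oT).
exists a; split=> //; apply/sgeP => b ba.
by have [/a_min/(oltNge ba)|] := sle_or_sgt Y b.
Qed.

(** Take [C] such that [Y & C] has stature exactly [r].  If [Y - C] had stature
    [d < omega ^ b], then [Y] would have stature at most
    [r (+) d = r + d < r + omega ^ b]. *)
Lemma sge_split Y r b : nclosed b r -> sge Y (oadd r (opow b)) ->
  exists C, [/\ closed C, sge (Y `&` C) r & sge (Y `\` C) (opow b)].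
Proof.
move=> br Yrb; have [C [cC Yle Yge]] := sge_exact (sge_le (ole_addr _ _) Yrb).
exists C; split=> //; apply: (sge_setD Yrb Yle) => d db.
exact: ole_olt_trans (nclosed_nadd br db) (oadd_ltr _ db).
Qed.

(** A set of stature at most [omega ^ g * n] is a finite union of sets of stature
    at most [omega ^ g]; this is phrased as an induction principle. *)
Lemma sle_pieces (P : set T -> Prop) g n Y :
  (forall Z, sle Z (opow g) -> P Z) -> (forall Z Z', P Z -> P Z' -> P (Z `|` Z')) ->
  sle Y (omuln (opow g) n) -> P Y.
Proof.
move=> P1 PU; elim: n Y => [|n IHn] Y Yn; first exact/P1/(sle_le (ole0 _) Yn).
have [/P1//|/sgt_sge/sge_exact[C [cC Yle Yge]]] := sle_or_sgt Y (opow g).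
rewrite -(setUIDK Y C); apply: PU; first exact: P1.
apply/IHn/(sle_setD cC Yge)/(sle_le _ Yn).
by have [] := omulnS (opow g) n.
Qed.

End Bounded.

Lemma sle_Acc (A : hoare0 T) a : sle (sval A) a -> Acc (@hoare0_lt T) A.
Proof.
elim: a A => K f IHf A Af; constructor=> B [BA AB].
have [i] := Af (sval B) (svalP B) AB; rewrite (setIidr BA); exact: IHf.
Qed.

Lemma stature_rank_acc (A : hoare0 T) (aA : Acc (@hoare0_lt T) A) :
  sle (sval A) (rank_acc aA) /\ sge (sval A) (rank_acc aA).
Proof.
have Ax := aA; elim: Ax aA => {}A _ IHA [aA] /=; split=> [C cC AC|[B BA]].
  have cAC : closed (sval A `&` C) by apply: closedI => //; exact: svalP A.
  pose B : hoare0 T := exist _ _ cAC.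
  have BA : hoare0_lt B A by split=> [|h]; [exact: subIsetl|apply: AC => x /h[]].
  by exists (exist _ B BA); have [] := IHA B BA (Acc_inv (Acc_intro _ aA) BA).
exists (sval B); split; [exact: svalP B|by case: BA|].
have [BA' _] := BA; rewrite (setIidr BA').
by have [] := IHA B BA (Acc_inv (Acc_intro _ aA) BA).
Qed.

Lemma stature_eq a : sle setT a -> sge setT a -> stature T =ord a.
Proof.
move=> Tle Tge; rewrite /stature /rank; case: pselect => [aT|]; last first.
  by case; exact: (@sle_Acc (hoare0_top T) a).
by have [le ge] := stature_rank_acc aT; split; [exact: sge_sle ge Tle|exact: sge_sle Tge le].
Qed.

Lemma noetherian_stature : noetherian T -> sle setT (stature T) /\ sge setT (stature T).
Proof.
move=> nT; rewrite /stature /rank; case: pselect => [aT|[]].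
  exact: stature_rank_acc aT.
exact: noetherian_wf.
Qed.

End Subsets.

(** Statures do not decrease along a map for which the topology of the source is
    the initial one. *)
Lemma sge_map (T1 T2 : topologicalType) (f : T1 -> T2) (Y1 : set T1) (Y2 : set T2) a :
  (forall x, Y1 x -> Y2 (f x)) ->
  (forall C1, closed C1 -> exists2 C2, closed C2 & forall x, Y1 x -> C1 x <-> C2 (f x)) ->
  sge Y1 a -> sge Y2 a.
Proof.
elim: a Y1 Y2 => K g IHg Y1 Y2 Y12 init Y1g i.
have [C1 [cC1 YC1 Y1i]] := Y1g i; have [C2 cC2 C12] := init _ cC1.
exists C2; split=> //; first by move=> YC2; apply: YC1 => x Yx; apply/C12/YC2/Y12.
apply: IHg Y1i => [x [Yx /C12 Cx]|D1 cD1]; first by split; [exact: Y12|exact: Cx].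
by have [D2 cD2 D12] := init _ cD1; exists D2 => // x [/D12].
Qed.
(** * Lists matching lists of sets *)

Fixpoint rel2 (A B : Type) (R : A -> B -> Prop) (s : seq A) (t : seq B) : Prop :=
  match s, t with
  | x :: s', y :: t' => R x y /\ rel2 R s' t'
  | [::], [::] => True
  | _, _ => False
  end.

Section Rel2.
Variables (A B : Type) (R : A -> B -> Prop).

Lemma rel2_size s t : rel2 R s t -> size s = size t.
Proof. by elim: s t => [|x s IHs] [|y t] //= [_ /IHs->]. Qed.

Lemma rel2_cat s1 s2 t1 t2 :
  rel2 R s1 t1 -> rel2 R s2 t2 -> rel2 R (s1 ++ s2) (t1 ++ t2).
Proof. by elim: s1 t1 => [|x s IHs] [|y t] //= [xy /IHs h] /h. Qed.

Lemma rel2_catlP s1 s2 t : rel2 R (s1 ++ s2) t ->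
  exists t1 t2, [/\ t = t1 ++ t2, rel2 R s1 t1 & rel2 R s2 t2].
Proof.
elim: s1 t => [|x s IHs] t; first by exists [::], t.
case: t => //= y t [xy /IHs[t1 [t2 [-> st1 st2]]]].
by exists (y :: t1), t2.
Qed.

End Rel2.

Lemma rel2_flip A B (R : A -> B -> Prop) s t :
  rel2 R s t -> rel2 (fun x y => R y x) t s.
Proof. by elim: s t => [|x s IHs] [|y t] //= [xy /IHs]. Qed.

Lemma rel2_catrP A B (R : A -> B -> Prop) s t1 t2 : rel2 R s (t1 ++ t2) ->
  exists s1 s2, [/\ s = s1 ++ s2, rel2 R s1 t1 & rel2 R s2 t2].
Proof.
move=> /rel2_flip/rel2_catlP[s1 [s2 [-> /rel2_flip h1 /rel2_flip h2]]].
by exists s1, s2.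
Qed.

(** Rearranging one of two related lists forces a rearrangement of the other. *)
Lemma rel2_perml (A B : eqType) (R : A -> B -> Prop) s s' t :
  perm_eq s s' -> rel2 R s t -> exists2 t', perm_eq t t' & rel2 R s' t'.
Proof.
elim: s' s t => [|x s' IHs] s t.
  by move=> /perm_nilP-> ; case: t => // _; exists [::].
move=> ss'; have xs : x \in s by rewrite (perm_mem ss') mem_head.
case/splitPr: xs ss' => s1 s2 ss' /rel2_catlP[t1 [[|y t2] [-> st1 //= [xy st2]]]].
have /IHs/(_ (rel2_cat st1 st2))[t' tt' st'] : perm_eq (s1 ++ s2) s'.
  by rewrite -(perm_cons x) -(permPr ss') -cat1s perm_catCA.
exists (y :: t') => //; rewrite -cat1s perm_catCA.
by rewrite perm_cons.
Qed.

Lemma rel2_permr (A B : eqType) (R : A -> B -> Prop) s t t' :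
  perm_eq t t' -> rel2 R s t -> exists2 s', perm_eq s s' & rel2 R s' t'.
Proof.
by move=> tt' /rel2_flip/(rel2_perml tt')[s' ss' /rel2_flip]; exists s'.
Qed.

(** * The topology of finite multisets *)

Section Multisets.
Variable X : topologicalType.
Implicit Types (v w : seq X) (U V : set X) (Us Vs : seq (set X)).

Definition matches w Us : Prop := rel2 (fun x U => U x) w Us.

(** As [parikh] identifies permuted words, it is the sets [hits _ Us] that describe
    the topology of multisets, in place of the ordered [word_basic Us]. *)
Definition hits w Us : Prop :=
  exists v r, perm_eq w (v ++ r) /\ matches v Us.

Definition all_open Us : Prop := forall U, U \in Us -> open U.

Lemma all_open_cat Us Vs : all_open (Us ++ Vs) <-> all_open Us /\ all_open Vs.
Proof.
split=> [h|[hU hV] U]; last by rewrite mem_cat => /orP[/hU|/hV].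
by split=> U UU; apply: h; rewrite mem_cat UU ?orbT.
Qed.

Lemma all_open_nseq n U : open U -> all_open (nseq n U).
Proof. by move=> oU V; rewrite mem_nseq => /andP[_ /eqP->]. Qed.

Lemma matches_nseq w n U :
  matches w (nseq n U) <-> size w = n /\ forall x, x \in w -> U x.
Proof.
elim: n w => [|n IHn] [|x w] /=; split=> //; try by case.
  case=> Ux /IHn[<- wU]; split=> // y; rewrite inE => /predU1P[->//|/wU//].
case=> -[wn] wU; split; first by apply: wU; exact: mem_head.
by apply/IHn; split=> // y yw; apply: wU; rewrite inE yw orbT.
Qed.

Lemma hits_perm w w' Us : perm_eq w w' -> hits w Us -> hits w' Us.
Proof. by move=> ww' [v [r [wvr vU]]]; exists v, r; rewrite -(permPl ww'). Qed.

Lemma hits_perm_sets w Us Vs : perm_eq Us Vs -> hits w Us -> hits w Vs.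
Proof.
move=> UV [v [r [wvr /(rel2_permr UV)[v' vv' v'V]]]]; exists v', r; split=> //.
by rewrite (permPl wvr) perm_cat2r.
Qed.

Lemma hits_catl w Us Vs : hits w (Us ++ Vs) -> hits w Us.
Proof.
move=> [v [r [wvr /rel2_catrP[v1 [v2 [vE vU _]]]]]]; exists v1, (v2 ++ r).
by rewrite catA -vE.
Qed.

Lemma hits_cat v w Us Vs : matches v Us -> hits w Vs -> hits (w ++ v) (Vs ++ Us).
Proof.
move=> vU [w1 [r [wE wV]]]; exists (w1 ++ v), r; split; last exact: rel2_cat.
rewrite -catA (permPr (_ : perm_eq _ (w1 ++ r ++ v))) ?catA ?perm_cat2r //.
by rewrite -!catA perm_cat2l perm_catC.
Qed.

Lemma hits_sub w Us Vs :
  rel2 (fun U V => U `<=` V) Us Vs -> hits w Us -> hits w Vs.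
Proof.
move=> UV [v [r [wvr vU]]]; exists v, r; split=> //.
elim: v Us Vs UV vU {wvr} => [|x v IHv] [|U Us] [|V Vs] //= [UV /IHv h] [/UV ? /h].
by [].
Qed.

Definition count_in U w : nat := count (fun x => x \in U) w.

Lemma count_in_all U w : (forall x, x \in w -> U x) -> count_in U w = size w.
Proof.
move=> wU; apply/eqP; rewrite -all_count; apply/allP => x /wU Ux.
by rewrite in_setE.
Qed.

Lemma count_in_none U w : (forall x, x \in w -> ~ U x) -> count_in U w = 0.
Proof.
move=> wU; apply/eqP; rewrite -leqn0 leqNgt -has_count; apply/hasPn => x /wU nUx.
by apply/negP; rewrite in_setE.
Qed.

(** Hall's condition in a crude form: if each set has at least as many letters as
    there are sets, distinct letters can be chosen greedily. *)
Lemma count_hits w Us :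
  (forall U, U \in Us -> (size Us <= count_in U w)%N) -> hits w Us.
Proof.
elim: Us w => [|U Us IHU] w h; first by exists [::], w.
have /hasP[x xw] : has (fun x => x \in U) w.
  by rewrite has_count; apply: leq_trans (h U (mem_head _ _)).
rewrite in_setE => Ux.
have [V VU|v [r [wvr vU]]] := IHU (rem x w); last first.
  by exists (x :: v), r; split=> //=; rewrite (permPl (perm_to_rem xw)) perm_cons.
have := h V; rewrite inE VU orbT => /(_ isT).
rewrite /count_in (permP (perm_to_rem xw)) /= => /leq_trans/(_ (leq_add (leq_b1 _) (leqnn _))).
by rewrite add1n.
Qed.

Lemma hits_nseq w n U : hits w (nseq n U) <-> (n <= count_in U w)%N.
Proof.
split=> [[v [r [wvr /matches_nseq[<- vU]]]]|h].
  by rewrite /count_in (permP wvr) count_cat -/(count_in U v) count_in_all // leq_addr.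
by apply: count_hits => V; rewrite mem_nseq size_nseq => /andP[_ /eqP->].
Qed.

Lemma word_basic_cons U Us w : word_basic (U :: Us) w <->
  exists a x b, [/\ w = a ++ x :: b, U x & word_basic Us b].
Proof.
split=> [[a _ [_ [_ [x Ux <-] [b bU <-]] <-]]|[a [x [b [-> Ux bU]]]]].
  by exists a, x, b.
by exists a => //; exists (x :: b) => //; exists [:: x]; [exists x|exists b].
Qed.

Lemma word_basic_catl Us a b : word_basic Us b -> word_basic Us (a ++ b).
Proof.
case: Us => //= U Us /word_basic_cons[c [x [d [-> Ux dU]]]].
by apply/word_basic_cons; exists (a ++ c), x, d; rewrite catA.
Qed.

Lemma word_basic_matches Us v r : matches v Us -> word_basic Us (v ++ r).
Proof.
elim: Us v => [|U Us IHU] [|x v] //= [Ux /IHU h].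
by apply/word_basic_cons; exists [::], x, (v ++ r).
Qed.

Lemma word_basic_hits Us w : word_basic Us w -> hits w Us.
Proof.
elim: Us w => [|U Us IHU] w; first by exists [::], w.
move=> /word_basic_cons[a [x [b [-> Ux /(word_basic_catl a)/IHU[v [r [h vU]]]]]]].
exists (x :: v), r; split=> //=.
by rewrite -cat1s perm_catCA perm_cons.
Qed.

Lemma word_basic_nseqT k Us w : word_basic (nseq k setT ++ Us) w -> word_basic Us w.
Proof.
elim: k w => //= k IHk w /word_basic_cons[a [x [b [-> _ /IHk h]]]].
by rewrite -cat_rcons; exact: word_basic_catl.
Qed.

Fixpoint setIs Us Vs : seq (set X) :=
  match Us, Vs with
  | U :: Us', V :: Vs' => (U `&` V) :: setIs Us' Vs'
  | _, _ => [::]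
  end.

Lemma matches_setIs w Us Vs : matches w Us -> matches w Vs -> matches w (setIs Us Vs).
Proof.
by elim: w Us Vs => [|x w IHw] [|U Us] [|V Vs] //= [Ux /IHw h] [Vx /h].
Qed.

Lemma all_open_setIs Us Vs : all_open Us -> all_open Vs -> all_open (setIs Us Vs).
Proof.
elim: Us Vs => [|U Us IHU] [|V Vs] //= oU oV W; rewrite inE => /predU1P[->|].
  by apply: openI; [apply: oU|apply: oV]; exact: mem_head.
by apply: IHU => W' WW; [apply: oU|apply: oV]; rewrite inE WW orbT.
Qed.

Lemma setIs_subl Us Vs : size Us = size Vs ->
  rel2 (fun U V => U `<=` V) (setIs Us Vs) Us.
Proof.
by elim: Us Vs => [|U Us IHU] [|V Vs] //= [/IHU h]; split=> //; exact: subIsetl.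
Qed.

Lemma setIs_subr Us Vs : size Us = size Vs ->
  rel2 (fun U V => U `<=` V) (setIs Us Vs) Vs.
Proof.
by elim: Us Vs => [|U Us IHU] [|V Vs] //= [/IHU h]; split=> //; exact: subIsetr.
Qed.

Lemma word_basic_sub Us Vs :
  rel2 (fun U V => U `<=` V) Us Vs -> word_basic Us `<=` word_basic Vs.
Proof.
elim: Us Vs => [|U Us IHU] [|V Vs] //= [UV /IHU h] w.
move=> /word_basic_cons[a [x [b [-> /UV Vx /h bV]]]].
by apply/word_basic_cons; exists a, x, b.
Qed.

(** Padding with [setT] gives one open set for each letter of the word; such
    neighbourhoods of a given word can be intersected letter by letter. *)
Lemma word_basic_refine Us w : all_open Us -> word_basic Us w -> exists Vs,
  [/\ all_open Vs, matches w Vs & word_basic Vs `<=` word_basic Us].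
Proof.
elim: Us w => [|U Us IHU] w oU.
  exists (nseq (size w) setT); split=> //; first exact/all_open_nseq/openT.
  exact/matches_nseq.
case/word_basic_cons => a [x [b [-> Ux bU]]].
have [|Vs [oV bV sV]] := IHU b _ bU; first by move=> V VU; apply: oU; rewrite inE VU orbT.
exists (nseq (size a) setT ++ U :: Vs); split.
- apply/all_open_cat; split; first exact/all_open_nseq/openT.
  by move=> V; rewrite inE => /predU1P[->|/oV//]; apply: oU; exact: mem_head.
- by apply: rel2_cat => //; exact/matches_nseq.
move=> c /word_basic_nseqT/word_basic_cons[a' [y [b' [-> Uy /sV b'U]]]].
by apply/word_basic_cons; exists a', y, b'.
Qed.

Lemma word_open_nbhs (O : set (word_space X)) w : open O -> O w -> exists Vs,
  [/\ all_open Vs, matches w Vs & word_basic Vs `<=` O].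
Proof.
case=> D sD <- [A DA]; have [E sE EA] := sD _ DA; rewrite -EA in DA * => Ew.
have [e eE] : exists e : seq (seq (set X)), forall Us, Us \in E = (Us \in e) by exists E.
suff [Vs [oV wV VE]] : exists Vs, [/\ all_open Vs, matches w Vs &
    forall Us, Us \in e -> word_basic Vs `<=` word_basic Us].
  exists Vs; split=> // w' w'V; exists (\bigcap_(Us in [set` E]) word_basic Us).
    exact: DA.
  by move=> Us /=; rewrite eE => /VE; apply.
have: forall Us, Us \in e -> all_open Us /\ word_basic Us w.
  by move=> Us; rewrite -eE => UE; split; [have /set_mem := sE _ UE|exact: Ew].
elim: e {eE} => [_|Us s IHs h].
  exists (nseq (size w) setT); split=> //; first exact/all_open_nseq/openT.
  exact/matches_nseq.
have [|Vs [oV wV sV]] := IHs; first by move=> Vs Vss; apply: h; rewrite inE Vss orbT.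
have [oU wU] := h Us (mem_head _ _).
have [Ws [oW wW sW]] := word_basic_refine oU wU.
have VW : size Vs = size Ws by rewrite -(rel2_size wV) (rel2_size wW).
exists (setIs Vs Ws); split; [exact: all_open_setIs|exact: matches_setIs|].
move=> Us'; rewrite inE => /predU1P[->|/sV VU].
  by apply: subset_trans sW; exact/word_basic_sub/setIs_subr.
by apply: subset_trans VU; exact/word_basic_sub/setIs_subl.
Qed.

Lemma open_word_basic Us : all_open Us -> open (word_basic Us : set (word_space X)).
Proof.
move=> oU; exists [set word_basic Us]; last by rewrite bigcup_set1.
move=> _ ->; exact: finI_from1.
Qed.

Lemma parikh_eq v w : parikh v = parikh w :> multiset_space X <-> perm_eq v w.
Proof. by split=> /eq_seq_msetP. Qed.

Lemma parikh_surj (m : multiset_space X) : exists w, m = parikh w.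
Proof. by exists (m : {mset X}%mset); rewrite /parikh seq_mset_id. Qed.

(** The words that hit [Us] are permutations of words in the basic open set of
    [Us], and the preimage of [C] is invariant under permutation. *)
Lemma closed_nbhs (C : set (multiset_space X)) w : closed C -> ~ C (parikh w) ->
  exists Us, [/\ all_open Us, matches w Us &
    forall w', hits w' Us -> ~ C (parikh w')].
Proof.
move=> cC nCw; have oC : open (@parikh X @^-1` (~` C)) by exact: closed_openC cC.
have [Us [oU wU sU]] := word_open_nbhs oC nCw.
exists Us; split=> // w' [v [r [w'vr vU]]].
rewrite (_ : parikh w' = parikh (v ++ r)); last exact/parikh_eq.
exact/sU/word_basic_matches.
Qed.

(** A set of multisets, as [hits] does not depend on the order of a word. *)
Definition misses Us : set (multiset_space X) :=
  [set m | forall w, m = parikh w -> ~ hits w Us].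

Lemma missesP Us w : misses Us (parikh w) <-> ~ hits w Us.
Proof.
split=> [|nw v /parikh_eq wv hv]; first by apply.
by apply: nw; apply: hits_perm hv; rewrite perm_sym.
Qed.

(** A word hits [Us] iff it lies in the basic open set of some rearrangement of
    [Us] padded with copies of [setT]. *)
Lemma closed_misses Us : all_open Us -> closed (misses Us).
Proof.
move=> oU; rewrite -(setCK (misses Us)); apply: open_closedC.
rewrite /open /= /multiset_open /=.
pose D := [set p : nat * seq (set X) | perm_eq p.2 (Us ++ nseq p.1 setT)].
rewrite (_ : _ @^-1` _ = \bigcup_(p in D) word_basic p.2).
  apply: bigcup_open => -[k Vs] /= VU; apply: open_word_basic => V.
  by rewrite (perm_mem VU) mem_cat mem_nseq => /orP[/oU//|/andP[_ /eqP->]]; exact: openT.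
apply/seteqP; split=> w /=.
  move=> /missesP/contrapT[v [r [wvr vU]]].
  have vrU : matches (v ++ r) (Us ++ nseq (size r) setT).
    by apply: rel2_cat => //; exact/matches_nseq.
  have [Vs UV wV] := rel2_perml (etrans (perm_sym _ _) wvr) vrU.
  exists (size r, Vs); first by rewrite /D /= perm_sym.
  by rewrite -(cats0 w); exact: word_basic_matches.
move=> [[k Vs] /= VU /word_basic_hits/(hits_perm_sets VU)/hits_catl wU].
by move=> /missesP.
Qed.

Lemma misses_nseq n U w : misses (nseq n U) (parikh w) <-> (count_in U w < n)%N.
Proof.
rewrite missesP hits_nseq ltnNge; split=> [h|/negP//]; exact/negP.
Qed.

(** * Products of subsets in the space of multisets *)

(** The entries from [Cs] are compulsory: this makes the set empty when some
    member of [Cs] is, and lets a finite bound on the number of entries in an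
    open set be expressed by a finite union. *)
Definition multiset_product (F : set X) (Cs : seq (set X)) : set (multiset_space X) :=
  [set m | exists w v, [/\ m = parikh (w ++ v), forall x, x \in w -> F x & matches v Cs]].

End Multisets.
(** * The upper bound *)

Section Upper.
Variable X : topologicalType.
Implicit Types (v w : seq X) (U V F : set X) (Us Vs Cs : seq (set X)).

Section Small.
Variables (T : topologicalType) (E : Ord).
Implicit Types Y Z : set T.

(** Being of stature below [omega ^ E] is stable under finite unions. *)
Definition small Y : Prop := exists2 b, b <o opow E & sle Y b.

Lemma small_sub Y Z : Z `<=` Y -> small Y -> small Z.
Proof. by move=> ZY [b bE Yb]; exists b => //; exact: sle_sub Yb. Qed.

Lemma small_setU Y Z : small Y -> small Z -> small (Y `|` Z).
Proof.
move=> [b bE Yb] [d dE Zd]; exists (nadd b d); first exact: nadd_opow_lt.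
exact: sle_setU.
Qed.

Lemma small_empty Y : (forall x, ~ Y x) -> small Y.
Proof.
move=> Y0; exists ozero; first exact: opow_gt0.
by apply/sleP => C _ []; move=> x /Y0.
Qed.

Lemma small_exists (I : eqType) (s : seq I) (W : I -> set T) :
  (forall i, i \in s -> small (W i)) -> small [set m | exists2 i, i \in s & W i m].
Proof.
elim: s => [_|i s IHs h]; first by apply: small_empty => x [].
apply: (@small_sub (W i `|` [set m | exists2 i, i \in s & W i m])); last first.
  apply: small_setU; first by apply: h; exact: mem_head.
  by apply: IHs => j js; apply: h; rewrite inE js orbT.
by move=> m [j]; rewrite inE => /predU1P[->|js Wm]; [left|right; exists j].
Qed.

End Small.

Variable o : Ord.
Hypothesis oX : sle (setT : set X) o.

Local Notation slots := (rel2 (fun (C : set X) c => sle C (opow c))).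

Lemma multiset_product_setU F Cs1 C C' Cs2 :
  multiset_product F (Cs1 ++ (C `|` C') :: Cs2) `<=`
  multiset_product F (Cs1 ++ C :: Cs2) `|` multiset_product F (Cs1 ++ C' :: Cs2).
Proof.
move=> m [w [v [-> wF /rel2_catrP[v1 [v2 [-> v1C]]]]]].
case: v2 => //= x v2 [[Cx|Cx] v2C]; [left|right];
  by exists w, (v1 ++ x :: v2); split=> //; apply: rel2_cat.
Qed.

(** Each copy of [B] is replaced by pieces of stature at most [omega ^ g]. *)
Lemma small_nseq E a g n F B k Cs cs :
  sle B (omuln (opow g) n) ->
  (forall Ds ds, slots Ds ds -> nadd a (nsum ds) <o E -> small E (multiset_product F Ds)) ->
  slots Cs cs -> nadd a (nadd (nsum (nseq k g)) (nsum cs)) <o E ->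
  small E (multiset_product F (nseq k B ++ Cs)).
Proof.
move=> Bn H; elim: k Cs cs => [|k IHk] Cs cs Ccs aE.
  by apply: (H _ cs) => //; apply: ole_olt_trans aE; exact/nadd_mono/ole_naddl/ole_refl.
have -> : nseq k.+1 B ++ Cs = nseq k B ++ B :: Cs.
  by rewrite -cat1s catA; congr (_ ++ _); elim: k {IHk aE} => //= k <-.
pose P Z := small E (multiset_product F (nseq k B ++ Z :: Cs)).
apply: (sle_pieces oX (P := P)) Bn => [Z Zg|Z Z' hZ hZ'].
  apply: (IHk _ (g :: cs)) => //=; apply: ole_olt_trans aE.
  apply: nadd_mono; first exact: ole_refl.
  apply: ole_trans (naddA_ge _ _ _) _; apply: nadd_mono; last exact: ole_refl.
  exact: nadd_comm_le.
exact: small_sub (@multiset_product_setU _ _ _ _ _) (small_setU hZ hZ').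
Qed.

(** The multisets whose entries from [Cs] fail to match the neighbourhood [Us] of
    some [v]: one of these entries is in [C - U], and the point of [v] in [C]
    and [U] witnesses that [C - U] is smaller than [C].  The list [Ds]
    accumulates the members of [Cs] that have been passed. *)
Lemma small_missed_slot E a F Cs cs Us v Ds ds :
  (forall Ds ds, slots Ds ds -> nadd a (nsum ds) <o E -> small E (multiset_product F Ds)) ->
  slots Cs cs -> slots Ds ds -> matches v Cs -> matches v Us -> all_open Us ->
  nadd a (nadd (nsum cs) (nsum ds)) <=o E ->
  small E [set m | exists w u1 u2, [/\ m = parikh (w ++ u1 ++ u2),
    forall x, x \in w -> F x, matches u1 Cs, ~ matches u1 Us & matches u2 Ds]].
Proof.
move=> H; elim: v Cs cs Us Ds ds => [|x v IHv] [|C Cs] [|c cs] [|U Us] Ds ds;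
  try by move=> Ccs _ vC vU; move: Ccs vC vU => /=.
  by move=> _ _ _ _ _ _; apply: small_empty => m [w [u1 [u2 [_ _ u1n nu1 _]]]].
move=> [Cc Ccs] Dds [Cx vC] [Ux vU] oU aE.
have oUs : all_open Us by move=> V VU; apply: oU; rewrite inE VU orbT.
have le1 : nadd a (nadd (nsum cs) (nsum (c :: ds))) <=o E.
  apply: ole_trans aE; apply: nadd_mono; first exact: ole_refl.
  apply: ole_trans (naddA_ge _ _ _) _; apply: nadd_mono; last exact: ole_refl.
  exact: nadd_comm_le.
have step : small E (multiset_product F ((C `\` U) :: Cs ++ Ds)).
  have cU : closed (~` U) by apply: open_closedC; apply: oU; exact: mem_head.
  have /sleP/(_ _ cU)[CU|b bc Cb] := Cc; first by case: (CU x Cx).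
  have [b0|[c' c'c [n bn]]] := olt_powP bc.
    apply: small_empty => m [w [[|y u] [_ _]]] // [Cy _].
    have := sge_sle (sge1 Cy) (sle_le b0 Cb); exact: olt_irr.
  pose P Z := small E (multiset_product F (Z :: Cs ++ Ds)).
  apply: (sle_pieces oX (P := P)) (sle_le bn Cb) => [Z Zc'|Z Z' hZ hZ'].
    apply: (H _ (c' :: cs ++ ds)); first by split=> //; exact: rel2_cat.
    apply: (olt_ole_trans _ aE); apply: nadd_ltr.
    apply: olt_ole_trans (nadd_ltl _ c'c) _ => /=.
    apply: ole_trans (nadd_mono (ole_refl _) (nsum_cat _ _)) _.
    exact: naddA_ge.
  exact: small_sub (@multiset_product_setU _ [::] _ _ _) (small_setU hZ hZ').
have rest := IHv _ _ _ (C :: Ds) (c :: ds) Ccs (conj Cc Dds) vC vU oUs le1.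
apply: small_sub (small_setU step rest) => m [w [[|y u1] [u2 [-> wF //= [Cy u1C] nU u2D]]]].
have [Uy|nUy] := pselect (U y); [right|left].
  exists w, u1, (y :: u2); split=> //; last by move=> u1U; apply: nU.
  apply/parikh_eq; rewrite perm_cat2l -cat_cons -cat1s -(cat1s y u2).
  by rewrite -!catA perm_catCA.
by exists w, (y :: u1 ++ u2); split=> //=; split=> //; exact: rel2_cat.
Qed.

(** The multisets whose part over [F] does not hit the neighbourhood [Vs] of some
    [v0]: by [count_hits], some [V] in [Vs] has fewer than [size Vs] entries of
    it, which become as many new members of the list [Cs]. *)
Lemma small_missed_base E s a F Cs cs Vs v0 :
  (forall t F Ds ds, nonincreasing a t -> sle F (sum_opow t) -> slots Ds ds ->
     nadd (hat_seq t) (nsum ds) <o E -> small E (multiset_product F Ds)) ->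
  nonincreasing a s -> sle F (sum_opow s) -> slots Cs cs ->
  nadd (hat_seq s) (nsum cs) <=o E ->
  all_open Vs -> (forall x, x \in v0 -> F x) -> matches v0 Vs ->
  small E [set m | exists w u, [/\ m = parikh (w ++ u),
    forall x, x \in w -> F x, ~ hits w Vs & matches u Cs]].
Proof.
move=> H sa Fs Ccs sE oV vF vV.
pose W V k := multiset_product (F `&` ~` V) (nseq k (F `\` ~` V) ++ Cs).
apply: (@small_sub _ _ [set m | exists2 V, V \in Vs &
    [set m | exists2 k, k \in iota 0 (size Vs) & W V k m] m]).
  move=> m [w [u [-> wF nw uC]]].
  have [V VV wV] : exists2 V, V \in Vs & (count_in V w < size Vs)%N.
    apply: contrapT => no; apply: nw; apply: count_hits => V VV.
    by rewrite leqNgt; apply/negP => wV; apply: no; exists V.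
  exists V => //=; exists (count_in V w); first by rewrite mem_iota.
  exists [seq x <- w | x \notin V], ([seq x <- w | x \in V] ++ u); split.
  - apply/parikh_eq; rewrite catA perm_cat2r perm_sym perm_catC.
    exact/permPl/perm_filterC.
  - move=> x; rewrite mem_filter => /andP[/negP nVx /wF Fx]; split=> //.
    by move=> Vx; apply: nVx; exact: mem_set.
  - apply: rel2_cat => //; apply/matches_nseq; split; first by rewrite size_filter.
    move=> x; rewrite mem_filter => /andP[/set_mem Vx /wF Fx].
    by split=> // nVx; exact: nVx.
apply: small_exists => V VV; apply: small_exists => k _; rewrite /W.
have cV : closed (~` V) by apply: open_closedC; exact: oV.
(* the entry of [v0] matched with [V], so that [F - V] is smaller than [F] *)
have [x Fx Vx] : exists2 x, F x & V x.
  elim: v0 Vs VV vV {oV} vF => [|y v0 IHv] [|V' Vs] //; rewrite inE.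
  move=> /predU1P[<-|VV] [Vy vV] vF; first by exists y => //; apply: vF; exact: mem_head.
  by apply: IHv VV vV _ => z zv; apply: vF; rewrite inE zv orbT.
have /sleP/(_ _ cV)[FV|b bs Fb] := Fs; first by case: (FV x Fx).
(* the exact value of the stature of [F - V] is needed to bound [F & V] *)
have [r [Fr_le Fr_ge]] := stature_exists oX (F `&` ~` V).
have rs : r <o sum_opow s by exact: ole_olt_trans (sge_sle Fr_ge Fb) bs.
have [p [g [q [d [sE' rE dg]]]]] := olt_sum_opow rs; subst s.
have [t [td dE]] := cnf_exists d.
have tg : for_all (fun b => b <o g) t by exact: cnf_lt dg (conj td dE).
have [pa gp ga gq] := nonincreasing_catP sa.
have pta : nonincreasing a (p ++ t).
  apply: (nonincreasing_cat gp pa ga).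
  by case: t td tg {dE} => //= c t [_ ct] [/oltW cg _].
have rpt : r <=o sum_opow (p ++ t).
  have [_] := sum_opow_cat p t; apply: ole_trans.
  case: rE => re _; apply: ole_trans re _; apply: oadd_monor.
  by case: dE.
(* cancel the common part [p] of the normal forms of [F - V] and [F] *)
have Fq : sle (F `\` ~` V) (omuln (opow g) (size (g :: q))).
  apply: sle_le (@sle_setD _ _ _ (sum_opow p) (sum_opow (g :: q)) cV _ _).
  - apply: sum_opow_ole; split; first exact: ole_refl.
    exact: nonincreasing_all.
  - apply: sge_le Fr_ge; case: rE => _; apply: ole_trans; exact: ole_addr.
  - by apply: sle_le Fs; have [] := sum_opow_cat p (g :: q).
apply: (small_nseq (a := hat_seq (p ++ t)) Fq _ Ccs).
  move=> Ds ds Dds; apply: H => //; exact: sle_le Fr_le.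
apply: ole_olt_trans (naddA_ge _ _ _) _.
apply: olt_ole_trans (nadd_ltl _ _) sE.
exact: hat_seq_lt sa tg.
Qed.

(** A closed set missing a point [w ++ v] misses a neighbourhood of it, and is
    therefore covered by the sets of the two preceding lemmas. *)
Lemma multiset_product_ole E s a F Cs cs :
  nonincreasing a s -> sle F (sum_opow s) -> slots Cs cs ->
  nadd (hat_seq s) (nsum cs) <=o E -> sle (multiset_product F Cs) (opow E).
Proof.
elim/olt_ind: E s F Cs cs => E IH s F Cs cs sa Fs Ccs sE.
have H t F' Ds ds : nonincreasing a t -> sle F' (sum_opow t) -> slots Ds ds ->
    nadd (hat_seq t) (nsum ds) <o E -> small E (multiset_product F' Ds).
  move=> ta Ft Dds tE; exists (opow (nadd (hat_seq t) (nsum ds))); first exact: opow_lt.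
  exact: (IH _ tE t _ _ ds) (ole_refl _).
apply/sleP => K cK /existsNP[m /not_implyP[[w [v [-> wF vC]]] nK]].
have [Ws [oW wW sW]] := closed_nbhs cK nK.
have [Vs [Us [WE wV vU]]] := rel2_catlP wW; subst Ws.
have [oV oU] : all_open Vs /\ all_open Us by exact/all_open_cat.
have A := small_missed_slot (Ds := [::]) (ds := [::])
  (fun Ds ds => H s F Ds ds sa Fs) Ccs I vC vU oU.
have B := small_missed_base H sa Fs Ccs sE oV wF wV.
apply: small_sub (small_setU (A _) B); last first.
  apply: ole_trans (nadd_mono (ole_refl _) (nadda0 _)) sE.
move=> _ [[w' [v' [-> w'F v'C]]] Kw'].
have [v'U|nv'U] := pselect (matches v' Us); [right|left].
  exists w', v'; split=> // w'V; apply: sW Kw'; exact: hits_cat.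
by exists w', v', [::]; rewrite cats0.
Qed.

Lemma multisets_ole a s : nonincreasing a s -> sle (setT : set X) (sum_opow s) ->
  sle (setT : set (multiset_space X)) (opow (hat_seq s)).
Proof.
move=> sa Xs.
have := @multiset_product_ole (hat_seq s) s a setT [::] [::] sa Xs I (nadda0 _).
apply: sle_sub => m _; have [w ->] := parikh_surj m.
by exists w, [::]; rewrite cats0.
Qed.

End Upper.
(** * The lower bound *)

Lemma olt_opow_succ b x : ozero <o b -> x <o opow b -> osucc x <o opow b.
Proof.
move=> b0 xb; have b1 : osucc ozero <o opow b.
  by have [_ /ole_olt_trans] := opow0; apply; exact: opow_lt.
apply: ole_olt_trans (nadd_opow_lt xb b1).
exact: ole_olt_trans (ole_naddr x ozero) (nadd_ltr x (olt_succ ozero)).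
Qed.

Section SgeOpow.
Variable T : topologicalType.
Implicit Types Y : set T.

Lemma sge_opow Y e : sge Y (osucc ozero) ->
  (forall b n, b <o e -> sge Y (omuln (opow b) n)) -> sge Y (opow e).
Proof.
move=> Y1 h; apply/sgeP => x /olt_powP[x0|[b be [n xn]]].
  by apply/sgt_sge_succ; apply: sge_le Y1; exact: osucc_ole.
apply/sgt_sge_succ; apply: sge_le (h b n.+1 be).
exact: ole_olt_trans xn (omuln_ltS _ (opow_gt0 b)).
Qed.

(** Continuity of [fun x => omega ^ (y + x)] at [omega ^ g]. *)
Lemma sge_opow_lim Y y g : ozero <o g ->
  (forall b n, b <o g -> sge Y (opow (oadd y (omuln (opow b) n)))) ->
  sge Y (opow (oadd y (opow g))).
Proof.
move=> g0 h; apply: sge_opow; first by apply: sge_le (h ozero 0 g0); exact: opow_gt0.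
move=> c n cy.
have [b [m [bg cb]]] : exists b m, b <o g /\ c <o oadd y (omuln (opow b) m).
  have y0 : y <o oadd y (omuln (opow ozero) 1).
    apply: ole_olt_trans (ole_addr y ozero) (oadd_ltr _ _).
    exact: ole_olt_trans (ole0 _) (omuln_ltS 0 (opow_gt0 ozero)).
  have [cy'|[d dg cd]] := olt_addP cy.
    by exists ozero, 1; split=> //; exact: olt_trans cy' y0.
  have [d0|[b bg [m dm]]] := olt_powP dg.
    exists ozero, 1; split=> //; apply: (ole_olt_trans _ y0).
    by apply: ole_trans cd (ole_trans (oadd_monor y d0) _); have [] := oadda0 y.
  exists b, m.+1; split=> //; apply: ole_olt_trans cd (oadd_ltr _ _).
  exact: ole_olt_trans dm (omuln_ltS _ (opow_gt0 b)).
by apply: sge_le (h b m bg); apply/oltW/omuln_opow_lt.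
Qed.

End SgeOpow.

Section Lower.
Variable X : topologicalType.
Implicit Types (v w : seq X) (U V F Z O : set X) (Us Vs Cs : seq (set X)).

Definition multisets F : set (multiset_space X) := multiset_product F [::].

Lemma multisetsP F w : multisets F (parikh w) <-> forall x, x \in w -> F x.
Proof.
split=> [[u [v [/parikh_eq wu uF]]]|wF]; last by exists w, [::]; rewrite cats0.
by case: v wu => //; rewrite cats0 => wu _ x; rewrite (perm_mem wu); exact: uF.
Qed.

Lemma multiset_product_nseqP F n Z m : multiset_product F (nseq n Z) m ->
  exists w v, [/\ m = parikh (w ++ v), forall x, x \in w -> F x, size v = n &
    forall x, x \in v -> Z x].
Proof. by move=> [w [v [-> wF /matches_nseq[vn vZ]]]]; exists w, v. Qed.

Lemma multiset_product_nseq F n Z w v : (forall x, x \in w -> F x) -> size v = n ->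
  (forall x, x \in v -> Z x) -> multiset_product F (nseq n Z) (parikh (w ++ v)).
Proof. by move=> wF vn vZ; exists w, v; split=> //; exact/matches_nseq. Qed.

(** Adding [n] copies of [x] embeds the multisets with [k] entries in [Z] and the
    others in [F] into [Y].  The topology is the initial one because [O1] and
    [O2] identify the entries: those in [O1] are the copies of [x] and the
    entries in [Z], and only the latter can be in [O2]. *)
Lemma sge_add_letter F Z O1 O2 x k n (Y : set (multiset_space X)) a :
  open O1 -> open O2 -> O2 `<=` O1 -> O1 x -> ~ O2 x -> Z `<=` O2 ->
  (forall y, F y -> ~ O1 y) ->
  (forall w v, (forall y, y \in w -> F y) -> size v = k -> (forall y, y \in v -> Z y) ->
     Y (parikh (nseq n x ++ w ++ v))) ->
  sge (multiset_product F (nseq k Z)) a -> sge Y a.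
Proof.
move=> oO1 oO2 O21 O1x nO2x ZO2 FO1 YP.
pose f (m : multiset_space X) : multiset_space X := parikh (nseq n x ++ (m : {mset X}%mset)).
have fE w : f (parikh w) = parikh (nseq n x ++ w).
  by apply/parikh_eq; rewrite perm_cat2l; exact: perm_eq_seq_mset.
apply: (sge_map (f := f)) => [m|C1 cC1].
  by move=> /multiset_product_nseqP[w [v [-> wF vk vZ]]]; rewrite fE; exact: YP.
pose good (p : seq (set X) * seq (set X)) :=
  [/\ all_open p.1, all_open p.2, size p.1 = k,
      (forall U, U \in p.1 -> U `<=` O2) &
      forall w, hits w (p.1 ++ p.2) -> ~ C1 (parikh w)].
(* the sets [p.1] are for the entries in [Z], the sets [p.2] for those in [F] *)
exists (\bigcap_(p in good) misses (nseq n O1 ++ p.1 ++ p.2)).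
  apply: closed_bigI => -[Us Vs] [oU oV _ _ _]; apply: closed_misses.
  by do !(apply/all_open_cat; split=> //); exact: all_open_nseq.
move=> m /multiset_product_nseqP[w [v [-> wF vk vZ]]]; rewrite fE; split; last first.
  move=> h; apply: contrapT => nC1.
  have wvC : ~ C1 (parikh (v ++ w)).
    by rewrite (_ : parikh (v ++ w) = parikh (w ++ v)) //; apply/parikh_eq; rewrite perm_catC.
  have [Ws [oW wW sW]] := closed_nbhs cC1 wvC.
  have [Us [Vs [WE vU wV]]] := rel2_catlP wW; subst Ws.
  have [oU oV] : all_open Us /\ all_open Vs by exact/all_open_cat.
  have Uk : size Us = k by rewrite -(rel2_size vU).
  pose Us2 := setIs Us (nseq k O2).
  have kO2 : size Us = size (nseq k O2) by rewrite size_nseq.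
  have vO2 : matches v (nseq k O2) by apply/matches_nseq; split=> // y /vZ/ZO2.
  have vU2 : matches v Us2 by exact: matches_setIs.
  have g : good (Us2, Vs).
    split=> //=; [|by rewrite -(rel2_size vU2)| |].
    - by apply: all_open_setIs => //; exact: all_open_nseq.
    - move=> U UU2; have := setIs_subr kO2; rewrite -/Us2.
      elim: (Us2) (k) UU2 => [|V Us' IHU] [|j] //=; rewrite inE.
      by move=> /predU1P[->|UU] [VO2 Us'O2]; [|exact: IHU UU Us'O2].
    - move=> u hu; apply: sW; apply: hits_sub hu.
      apply: rel2_cat; first exact: setIs_subl.
      by elim: (Vs) => //= V Vs' ?; split.
  have /missesP := h _ g; apply.
  exists (nseq n x ++ v ++ w), [::]; split.
    by rewrite cats0 perm_cat2l perm_catC.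
  apply: rel2_cat; last exact: rel2_cat.
  by apply/matches_nseq; rewrite size_nseq; split=> // y; rewrite mem_nseq => /andP[_ /eqP->].
move=> C1wv [Us Vs] [/= oU oV Uk UO2 gC1]; apply/missesP => -[u [r [wur]]].
move=> /rel2_catrP[v0 [v12 [uE /matches_nseq[v0n v0O1]]]].
move=> /rel2_catrP[v1 [v2 [v12E v1U v2V]]]; subst u v12.
have v1k : size v1 = k by rewrite (rel2_size v1U).
have v1O2 : forall y, y \in v1 -> O2 y.
  elim: v1 Us v1U UO2 {wur oU Uk gC1 v1k} => [|z v1 IHv] [|U Us] //= [Uz v1U] UO2 y.
  rewrite inE => /predU1P[->|yv1]; first by apply: (UO2 U) => //; exact: mem_head.
  by apply: (IHv Us) => // V VU; apply: UO2; rewrite inE VU orbT.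
(* [v0], [v1] are the letters found in the [n] copies of [O1] and in [Us] *)
suff v0x : v0 = nseq n x.
  apply: gC1 C1wv; exists (v1 ++ v2), r; split; last exact: rel2_cat.
  by move: wur; rewrite v0x -catA perm_cat2l.
have cO1 : count_in O1 (v2 ++ r) = 0.
  have := permP wur (fun y => y \in O1).
  rewrite !count_cat -/(count_in O1 w) -/(count_in O1 v) -/(count_in O1 v0)
    -/(count_in O1 v1) (count_in_none (w := w)); last by move=> y /wF/FO1.
  rewrite (count_in_all (w := v)); last by move=> y /vZ/ZO2/O21.
  rewrite (count_in_all v0O1) (count_in_all (w := v1)); last by move=> y /v1O2/O21.
  rewrite count_nseq mem_set // vk v0n v1k mul1n add0n /count_in count_cat.
  by rewrite -!addnA => /addnI/eqP; rewrite -{1}(addn0 k) eqn_add2l => /eqP<-.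
have cx : count_mem x v0 = n.
  have := permP wur (pred1 x); rewrite !count_cat count_nseq /= eqxx mul1n.
  have none (s : seq X) : (x \notin s) -> count_mem x s = 0 by move/count_memPn.
  rewrite (none w); last by apply/negP => /wF/FO1.
  rewrite (none v); last by apply/negP => /vZ/ZO2.
  rewrite (none v1); last by apply/negP => /v1O2.
  have : x \notin v2 ++ r.
    apply/negP => xr; have /hasP : exists2 y, y \in v2 ++ r & y \in O1.
      by exists x => //; exact: mem_set.
    by rewrite has_count -/(count_in O1 _) cO1.
  rewrite mem_cat negb_or => /andP[/none-> /none->].
  by rewrite !addn0.
by rewrite -v0n; apply/all_pred1P; rewrite all_count cx v0n.
Qed.

Lemma multisets_sub F Z : F `<=` Z -> multisets F `<=` multisets Z.
Proof.
by move=> FZ m; have [w ->] := parikh_surj m => /multisetsP wF; apply/multisetsP => x /wF/FZ.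
Qed.

Lemma multiset_product_sub F Z k :
  multiset_product F (nseq k Z) `<=` multisets (F `|` Z).
Proof.
move=> m /multiset_product_nseqP[w [v [-> wF _ vZ]]]; apply/multisetsP => x.
by rewrite mem_cat => /orP[/wF|/vZ]; [left|right].
Qed.

Lemma count_in_cat U v w : count_in U (v ++ w) = (count_in U v + count_in U w)%N.
Proof. exact: count_cat. Qed.

Lemma count_in_nseq U n x : U x -> count_in U (nseq n x) = n.
Proof.
move=> Ux; rewrite count_in_all ?size_nseq // => y.
by rewrite mem_nseq => /andP[_ /eqP->].
Qed.

Lemma count_in_sub U V w : U `<=` V -> (count_in U w <= count_in V w)%N.
Proof. by move=> UV; apply: sub_count => x /set_mem/UV/mem_set. Qed.

Lemma misses_nseq_sub m n U V : (m <= n)%N -> V `<=` U ->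
  misses (nseq m U) `<=` misses (nseq n V).
Proof.
move=> mn VU p; have [w ->] := parikh_surj p.
move=> /misses_nseq wm; apply/misses_nseq; apply: leq_trans mn.
exact: leq_ltn_trans (count_in_sub w VU) wm.
Qed.

(** For each [n], adding [n] copies of [x] embeds the multisets over [F] into
    those with exactly [n] entries in [O], and these layers add up. *)
Lemma sge_multisets_point F Z O x y :
  open O -> (forall z, F z -> ~ O z) -> Z x -> O x ->
  sge (multisets F) (opow y) -> sge (multisets (F `|` Z)) (opow (osucc y)).
Proof.
move=> oO FO Zx Ox Fy.
have layers n : sge (multisets (F `|` Z) `&` misses (nseq n O)) (omuln (opow y) n).
  elim: n => [|n IHn]; first exact: sge0.
  have cn : closed (misses (nseq n O)) by apply: closed_misses; exact: all_open_nseq.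
  apply: (sge_oadd cn).
    apply: sge_sub IHn => m [mFZ mn]; do !split=> //.
    exact: misses_nseq_sub (leqnSn n) (@subset_refl _ O) _ mn.
  have h := @sge_add_letter F set0 O set0 x 0 n; apply: (h _ _ oO) Fy => //.
    exact: open0.
  move=> w [|//] wF _ _; rewrite cats0.
  have cw : count_in O (nseq n x ++ w) = n.
    by rewrite count_in_cat count_in_nseq // count_in_none ?addn0 // => z /wF/FO.
  split; last by move=> /misses_nseq; rewrite cw ltnn.
  split; last by apply/misses_nseq; rewrite cw.
  apply/multisetsP => z; rewrite mem_cat mem_nseq => /orP[/andP[_ /eqP->]|/wF]; first by right.
  by left.
apply: sge_opow => [|b n /oltS by_].
  apply: sge_sub (@subIsetl _ _ (misses (nseq 1 O))) _; apply: sge_le (layers 1).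
  by have [_] := omuln1 (opow y); apply: ole_trans; exact: opow_gt0.
apply: sge_sub (@subIsetl _ _ (misses (nseq n O))) _; apply: sge_le (layers n).
by apply: omuln_mono (leqnn n); exact: opow_mono.
Qed.

Lemma open_setD O C : open O -> closed C -> open (O `\` C).
Proof. by move=> oO cC; rewrite setDE; apply: openI => //; exact: closed_openC. Qed.

Section Bounded.
Variable o : Ord.
Hypothesis oX : sle (setT : set X) o.

(** A set [below C] consists of the multisets for which some entry from [Z] is in
    [C].  The stature of the trace of [below C] increases by at least [mu]
    whenever the trace of [C] on [Z] grows by a point [x]: the new multisets
    include those formed by [x], by [k] entries in [Z - C] and by entries in
    [F], and [Z - C] still has stature at least [omega ^ b] as long as that of
    [Z & C] is less. *)
Lemma sge_multiset_product b F Z O k y : ozero <o b ->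
  open O -> Z `<=` O -> (forall z, F z -> ~ O z) ->
  sge (multisets F) (opow y) -> sge Z (opow b) ->
  sge (multiset_product F (nseq k Z)) (opow (oadd y (omuln b k))).
Proof.
move=> b0; elim: k Z O => [|k IHk] Z O oO ZO FO Fy Zb.
  by apply: sge_le Fy; apply: opow_mono; have [] := oadda0 y.
set mu := opow (oadd y (omuln b k)).
set N := multiset_product F (nseq k.+1 Z).
pose below C := misses (nseq k.+1 (O `\` C)).
have oOC C : closed C -> open (O `\` C) by exact: open_setD.
have inner d xi C : d <o opow b -> closed C -> sge (Z `&` C) xi -> sle (Z `&` C) d ->
    sge (N `&` below C) (omul mu xi).
  move=> db; elim/olt_ind: xi C => xi IHxi C cC Cxi Cd; apply/sgeP => t.
  case/olt_mulP => c [e [cxi emu te]]; apply/sgt_sge_succ.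
  have /sgeP/(_ _ cxi)[C' [cC' /existsNP[x /not_implyP[[Zx Cx] nC'x]] C'c]] := Cxi.
  have cCC : closed (C `&` C') by exact: closedI.
  apply: (@sge_le _ _ _ (oadd (omul mu c) mu)); first exact: ole_olt_trans te (oadd_ltr _ emu).
  have cB : closed (below (C `&` C')).
    by apply: closed_misses; apply: all_open_nseq; exact: oOC.
  have CB : O `\` C `<=` O `\` (C `&` C') by move=> z [Oz nCz]; split=> // -[].
  apply: (sge_oadd cB).
    have h : sge (N `&` below (C `&` C')) (omul mu c).
      apply: IHxi => //; first by rewrite setIA.
      by apply: sle_sub Cd => z [Zz [Cz _]].
    apply: sge_sub h => m [Nm mB]; do !split=> //.
    exact: misses_nseq_sub (leqnn _) CB _ mB.
  have ZC : sge (Z `\` C) (opow b).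
    by apply: (sge_setD Zb Cd) => d' d'b; exact: nadd_opow_lt.
  have ZCO : Z `\` C `<=` O `\` C by exact: setSD.
  have FOC z : F z -> ~ (O `\` C) z by move=> /FO nOz [].
  have FOCC z : F z -> ~ (O `\` (C `&` C')) z by move=> /FO nOz [].
  have src := IHk _ _ (oOC _ cC) ZCO FOC Fy ZC.
  apply: (@sge_add_letter F _ _ _ x k 1 _ _ (oOC _ cCC) (oOC _ cC) CB _ _ ZCO FOCC _ src).
  - by split; [exact: ZO|case].
  - by case.
  move=> w v wF vk vZC; split; [split|].
  - rewrite (_ : parikh _ = parikh (w ++ (x :: v))); last first.
      by apply/parikh_eq; rewrite /= -(cat1s x v) -cat1s perm_catCA.
    apply: multiset_product_nseq => //=; first by rewrite vk.
    by move=> z; rewrite inE => /predU1P[->//|/vZC[]].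
  - apply/misses_nseq; rewrite !count_in_cat (count_in_none (w := w)); last by move=> z /wF/FOC.
    rewrite (count_in_none (w := nseq 1 x)); last by move=> z; rewrite inE => /eqP-> [].
    by rewrite (count_in_all (w := v)) ?vk // => z /vZC/ZCO.
  - move=> /misses_nseq; rewrite !count_in_cat count_in_nseq; last by split; [exact: ZO|case].
    rewrite (count_in_all (w := v)); last by move=> z /vZC/ZCO/CB.
    by rewrite vk add1n ltnS ltnNge leq_addl.
have all_xi xi : xi <o opow b -> sge N (omul mu xi).
  move=> xib; have [C [cC Cle Cge]] := sge_exact oX (sge_le (oltW xib) Zb).
  exact: sge_sub (@subIsetl _ _ _) (inner xi xi C xib cC Cge Cle).
apply: (@sge_le _ _ _ (omul mu (opow b))).
  apply: ole_trans (opow_add _ _); apply: opow_mono; rewrite omuln_succ.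
  by have [] := oaddA y (omuln b k) b.
apply/sgeP => t /olt_mulP[c [e [cb emu te]]]; apply/sgt_sge_succ.
apply: sge_le (all_xi _ (olt_opow_succ b0 cb)).
have [_] := omul_succ mu c; apply: ole_trans.
exact: ole_olt_trans te (oadd_ltr _ emu).
Qed.

Definition grows b : Prop := forall F Z O y, open O -> Z `<=` O ->
  (forall z, F z -> ~ O z) -> sge (multisets F) (opow y) -> sge Z (opow b) ->
  sge (multisets (F `|` Z)) (opow (oadd y (opow (circ b)))).

(** Cut [Z] at the last term of the normal form and adjoin the two parts one after
    the other. *)
Lemma sge_multisets_sum a s F Z O y :
  for_all grows s -> nonincreasing a s -> open O -> Z `<=` O ->
  (forall z, F z -> ~ O z) -> sge (multisets F) (opow y) -> sge Z (sum_opow s) ->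
  sge (multisets (F `|` Z)) (opow (oadd y (hat_seq s))).
Proof.
elim/last_ind: s Z => [|s b IHs] Z gs sa oO ZO FO Fy Zs.
  apply: sge_sub (multisets_sub (@subsetUl _ F Z)) _; apply: sge_le Fy.
  by apply: opow_mono; have [] := oadda0 y.
move: gs sa Zs; rewrite -cats1 => /for_all_cat[gs [gb _]] /nonincreasing_catP[sa bs _ _] Zs.
have Zsb : sge Z (oadd (sum_opow s) (opow b)).
  apply: sge_le Zs; have [_] := sum_opow_cat s [:: b]; apply: ole_trans.
  by apply: oadd_monor; exact: ole_addr.
have [C [cC ZC ZnC]] := sge_split oX (nclosed_sum_opow bs) Zsb.
have FZC : sge (multisets (F `|` (Z `&` C))) (opow (oadd y (hat_seq s))).
  by apply: IHs => // z [/ZO].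
have := gb (F `|` (Z `&` C)) (Z `\` C) (O `\` C) _ _ _ _ FZC ZnC.
rewrite -setUA setUIDK => h.
apply: sge_le (h _ _ _).
- apply: opow_mono; have [+ _] := oaddA y (hat_seq s) (opow (circ b)); apply: ole_trans.
  apply: oadd_monor; rewrite /hat_seq map_cat.
  have [+ _] := sum_opow_cat (map circ s) [:: circ b]; move/ole_trans; apply.
  by apply: oadd_monor; have [] := oadda0 (opow (circ b)).
- exact: open_setD.
- exact: setSD.
- by move=> z [/FO nOz []|[_ Cz] []].
Qed.

Lemma hat_seq_nseq n b : omuln (opow (circ b)) n <=o hat_seq (nseq n b).
Proof. by rewrite /hat_seq map_nseq; have [] := sum_opow_nseq n (circ b). Qed.

Lemma nonincreasing_nseq n b : nonincreasing b (nseq n b).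
Proof. by elim: n => //= n ?; split=> //; exact: ole_refl. Qed.

(** The shift by [circ] propagates along successors: if [b = c + 1] with [c]
    shifted, then [omega ^ (circ c) * m] is [omega ^ b * m], and the supremum
    over [m] is [omega ^ (b + 1)]. *)
Lemma grows_all b : grows b.
Proof.
elim/olt_ind: b => b IH F Z O y oO ZO FO Fy Zb.
have [b0|b0] := ole_zero_or b.
  (* [circ b = 0], and it suffices to adjoin one point of [Z] *)
  have [x Zx] : exists x, Z x.
    apply: contrapT => Z0; have /sgeP/(_ _ (opow_gt0 b))[C [_ ZC _]] := Zb.
    by apply: ZC => x Zx; case: Z0; exists x.
  apply: sge_le (sge_multisets_point oO FO Zx (ZO _ Zx) Fy); apply: opow_mono.
  have [+ _] := oadd_succ y ozero; rewrite /= => h.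
  apply: (@ole_trans _ (oadd y (osucc ozero))); last first.
    by apply: ole_trans h _; apply: osucc_ole; have [] := oadda0 y.
  apply: oadd_monor; have [h0 _] := opow0; apply: ole_trans h0; apply: opow_mono.
  rewrite circ_far // => -[e [n [[_ ee] [_ eb]]]].
  have e0 : e <=o ozero by apply: ole_trans (ole_trans (ole_addr _ _) eb) b0.
  exact: (oltNge (opow_gt0 e) (ole_trans ee e0)).
have iter c m g : c <o b -> g <=o circ c ->
    sge (multisets (F `|` Z)) (opow (oadd y (omuln (opow g) m))).
  move=> cb gc; have gs : for_all grows (nseq m c) by apply: for_all_nseq; exact: IH.
  apply: sge_le (sge_multisets_sum gs (nonincreasing_nseq m c) oO ZO FO Fy _).
    apply/opow_mono/oadd_monor; apply: ole_trans (hat_seq_nseq m c).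
    by apply: omuln_mono (leqnn m); exact: opow_mono.
  apply: sge_le Zb; have [+ _] := sum_opow_nseq m c; move/ole_trans; apply.
  exact/oltW/omuln_opow_lt.
have [nb|fb] := pselect (near_critical b); last first.
  rewrite (circ_far fb); apply: sge_opow_lim => // c m cb.
  exact: iter (ole_circ c).
rewrite (circ_near nb); apply: sge_opow_lim; first exact: ole_olt_trans (ole0 b) (olt_succ b).
move=> g m /oltS gb; have [e [[|n] [ce [be eb]]]] := nb.
  (* [b] is critical, so that [b * m] is [omega ^ b * m] *)
  have [_ cb] : critical b.
    by apply: critical_eq ce; apply: oeq_sym; apply: oeq_trans (conj be eb) (oadda0 e).
  apply: sge_sub (@multiset_product_sub F Z m) _.
  apply: sge_le (sge_multiset_product m b0 oO ZO FO Fy Zb).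
  apply/opow_mono/oadd_monor/(omuln_mono _ (leqnn m)).
  exact: ole_trans (opow_mono gb) cb.
pose c := oadd e (onat n).
have nc : near_critical c by exists e, n; split=> //; exact: oeq_refl.
have [sc cs] : b =ord osucc c by apply: oeq_trans (conj be eb) (oadd_succ e (onat n)).
apply: (iter c) cs _.
by rewrite (circ_near nc); exact: ole_trans gb sc.
Qed.

Lemma multisets_sge a s : nonincreasing a s -> sge (setT : set X) (sum_opow s) ->
  sge (setT : set (multiset_space X)) (opow (hat_seq s)).
Proof.
move=> sa Xs.
have gs : for_all grows s by elim: s {sa Xs} => //= b s ?; split=> //; exact: grows_all.
have M0 : sge (multisets set0) (opow ozero).
  apply: (@sge_le _ _ _ (osucc ozero)); first by have [] := opow0.
  by apply: (@sge1 _ _ (parikh [::])); apply/multisetsP.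
have := sge_multisets_sum (F := set0) gs sa openT (@subsetT _ setT) _ M0 Xs.
move=> /(_ (fun z => False_ind _))/(sge_sub (@subsetT _ _)); apply: sge_le.
by apply: opow_mono; have [] := oadd0a (hat_seq s).
Qed.

End Bounded.
End Lower.

Theorem theorem14p20 (X : topologicalType) (hX : noetherian X) :
  stature (multiset_space X) =ord opow (hat (stature X)).
Proof.
have [Xle Xge] := noetherian_stature hX.
have [sa [ale age]] := cnfP (stature X).
apply: stature_eq.
  exact: (multisets_ole Xle sa (sle_le ale Xle)).
exact: (multisets_sge Xle sa (sge_le age Xge)).
Qed.
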